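(* Let $n\ge 2$, $\lambda=(\lambda_1,\dots,\lambda_n)\in\mathfrak h^*$, $\sigma\in S_n$, and $\bar\lambda=\lambda+(0,-1,-2,\dots,-n+1)$. If the graph $G=G(T_\sigma(\bar\lambda))$ is a relation graph, then the tableau $T_\sigma(\bar\lambda)$, viewed as a vector of the $\mathfrak{gl}_n$-module $V_G(T_\sigma(\bar\lambda))$, is a highest weight vector of weight $\lambda$ with respect to the triangular decomposition of $\mathfrak{gl}_n$ induced by $\sigma(\mathfrak h)$; that is, $E_{\sigma(i)\sigma(i)}T_\sigma(\bar\lambda)=\lambda_i T_\sigma(\bar\lambda)$ for $1\le i\le n$ and $E_{\sigma(i)\sigma(j)}T_\sigma(\bar\lambda)=0$ for $1\le i<j\le n$. In particular, $V_G(T_\sigma(\bar\lambda))$ is a highest weight module of highest weight $\lambda$ with respect to $\sigma(\mathfrak h)$ (i.e. with respect to this triangular decomposition).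
   Context: $\mathfrak h$ is the standard (diagonal) Cartan subalgebra of $\mathfrak{gl}_n(\mathbb C)$, $E_{ij}$ are the matrix units, and $\lambda\in\mathfrak h^*$ is identified with $(\lambda_1,\dots,\lambda_n)\in\mathbb C^n$, $\lambda_i=\lambda(E_{ii})$. **Graphs $G_\sigma$.** Let $\mathfrak V=\{(i,j): 1\le j\le i\le n\}$; $(k,1),\dots,(k,k)$ form row $k$, row $n$ being the top row. $\Sigma$ is the set of directed graphs on $\mathfrak V$ having, for each $1\le s<r\le n$, exactly one of the arrows $(r,s)\to(r-1,s)$ (then $A_{(r,s)}(G)=1$) or $(r-1,s)\to(r,s)$ (then $A_{(r,s)}(G)=-1$), and no other arrows. Let $\alpha_{ij}=\varepsilon_i-\varepsilon_j$ ($i\ne j$), $\Delta^+=\{\alpha_{ij}: i<j\}$, $\sigma(\alpha_{ij})=\alpha_{\sigma(i)\sigma(j)}$, and for $G\in\Sigma$ put $\mathcal Q_G=\{\alpha_{ij}: i<j, A_{(j,i)}(G)=1\}\cup\{\alpha_{ji}: i<j, A_{(j,i)}(G)=-1\}$. $G_\sigma$ is the unique element of $\Sigma$ with $\mathcal Q_{G_\sigma}=\sigma(\Delta^+)$. **Tableaux.** A Gelfand-Tsetlin tableau $T(L)$ is a triangular array of complex numbers $l_{ij}$ indexed by $(i,j)\in\mathfrak V$. For $X\in\mathbb C^n$, $T_\sigma(X)=T(Y)$ is defined by $y_{n,i}=x_{\sigma^{-1}(i)}$ and, recursively for $k=n,\dots,2$ and $1\le i\le k-1$, $y_{k-1,i}=y_{k,i}$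 if $G_\sigma$ has an arrow $(k,i)\to(k-1,i)$, and $y_{k-1,i}=y_{k,i}+1$ if $G_\sigma$ has an arrow $(k-1,i)\to(k,i)$. **Relation graphs.** All graphs are directed graphs on $\mathfrak V$ whose arrows connect only vertices in consecutive rows or vertices of row $n$, without oriented cycles or multiple arrows. $G$ is non-critical if any two vertices in the same row $k<n$ lying in the same connected component of the underlying unoriented graph are joined by an oriented path from one to the other. $T(L)$ satisfies $G$ if for each arrow $(i,j)\to(r,s)$ one has $l_{ij}-l_{rs}\in\mathbb Z_{\ge0}$ when the arrow is horizontal or points down ($r=i-1$), and $l_{ij}-l_{rs}\in\mathbb Z_{>0}$ when it points up ($r=i+1$). $T(L)$ is a $G$-realization if it satisfies $G$ and, for all $1\le k\le n-1$, $l_{ki}-l_{kj}\in\mathbb Z$ only if $(k,i),(k,j)$ are in the same connected component. For a $G$-realization $T(L)$, $V_G(T(L))$ is the complex vector space with basis all $G$-realizations $T(L+z)$, $z$ an integer array with $z_{ni}=0$ for all $i$. A non-critical $G$ is a relation graph if for every $G$-realization $T(L)$ the Gelfand-Tsetlin formulas $$E_{k,k+1}T(L)=-\sum_{i=1}^k\frac{\prod_{j=1}^{k+1}(l_{ki}-l_{k+1,j})}{\prod_{j\ne i}(l_{ki}-l_{kj})}T(L+\delta^{ki}),\quad E_{k+1,k}T(L)=\sum_{i=1}^k\frac{\prod_{j=1}^{k-1}(l_{ki}-l_{k-1,j})}{\prod_{j\ne i}(l_{ki}-l_{kj})}T(L-\delta^{ki}),$$ $$E_{kk}T(L)=\Big(k-1+\sum_{i=1}^kl_{ki}-\sum_{i=1}^{k-1}l_{k-1,i}\Big)T(L)$$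 define a $\mathfrak{gl}_n$-module structure on $V_G(T(L))$; here $T(L\pm\delta^{ki})$ is $T(L)$ with $\pm1$ added to entry $(k,i)$, and a summand is $0$ by definition if the new tableau is not a $G$-realization. **Graph of a tableau.** $G(T(L))$ is the transitive reduction (same reachability, minimal set of arrows) of the graph on $\mathfrak V$ with an arrow $(i,j)\to(r,s)$ if: (i) $i=r+1$ and $l_{ij}-l_{rs}\in\mathbb Z_{\ge0}$; or (ii) $i=r-1$ and $l_{ij}-l_{rs}\in\mathbb Z_{>0}$; or (iii) $i=r=n$, $j\neq s$, and $l_{nj}-l_{ns}\in\mathbb Z_{\ge0}$, where if $l_{nj}=l_{ns}$ only the arrow from the smaller to the larger index is taken. *)

(* Defs.v *)
From HB Require Import structures.
From mathcomp Require Import all_boot all_order all_algebra all_fingroup.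
From mathcomp Require Import boolp reals.
From mathcomp Require Import complex monalg.

Set Implicit Arguments.
Unset Strict Implicit.
Unset Printing Implicit Defensive.

Import Order.TTheory GRing.Theory Num.Theory.

Local Open Scope ring_scope.

(* All indices are shifted by one with respect to the mathematical text: rows *)
(* and columns are numbered 0, ..., n - 1, row r has r + 1 vertices, and the  *)
(* top row is row n - 1.                                                      *)

Notation vertex n := {p : 'I_n * 'I_n | (p.2 <= p.1)%N}.

Definition vrow (n : nat) (v : vertex n) : 'I_n := (val v).1.
Definition vcol (n : nat) (v : vertex n) : 'I_n := (val v).2.
Definition is_top (n : nat) (v : vertex n) : bool := (vrow v).+1 == n.

Notation graph n := {set vertex n * vertex n}.

Definition arrow (n : nat) (G : graph n) : rel (vertex n) :=
  fun u v => (u, v) \in G.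

Definition reach (n : nat) (G : graph n) : rel (vertex n) := connect (arrow G).

Definition same_component (n : nat) (G : graph n) : rel (vertex n) :=
  connect [rel u v | arrow G u v || arrow G v u].

(* has_arrow G (i, j) (r, s): there is an arrow from the vertex in row i and   *)
(* column j to the vertex in row r and column s (in particular these exist).   *)
Definition has_arrow (n : nat) (G : graph n) (p q : nat * nat) : bool :=
  [exists e in G, [&& nat_of_ord (vrow e.1) == p.1, nat_of_ord (vcol e.1) == p.2,
                      nat_of_ord (vrow e.2) == q.1 & nat_of_ord (vcol e.2) == q.2]].

Section Sigma.
Variable n : nat.

Definition arrow_down (G : graph n) (r s : nat) : bool :=  (* A_(r,s) = 1 *)
  has_arrow G (r, s) (r.-1, s).
Definition arrow_up (G : graph n) (r s : nat) : bool :=    (* A_(r,s) = -1 *)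
  has_arrow G (r.-1, s) (r, s).

Definition Sigma : {set graph n} :=
  [set G : graph n |
     [forall r : 'I_n, forall s : 'I_n,
        (s < r)%N ==> (arrow_down G r s (+) arrow_up G r s)]
  && [forall e in G, (vcol e.1 == vcol e.2) &&
        ((vrow e.1 == (vrow e.2).+1 :> nat) || (vrow e.2 == (vrow e.1).+1 :> nat))]].

(* The root alpha_{ij} = epsilon_i - epsilon_j is encoded by the pair (i, j). *)
Definition posroots : {set 'I_n * 'I_n} := [set a : 'I_n * 'I_n | (a.1 < a.2)%N].

Definition perm_roots (s : 'S_n) (A : {set 'I_n * 'I_n}) : {set 'I_n * 'I_n} :=
  [set (s a.1, s a.2) | a in A].

Definition Qroots (G : graph n) : {set 'I_n * 'I_n} :=
  [set a : 'I_n * 'I_n | (a.1 < a.2)%N && arrow_down G a.2 a.1]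
  :|: [set a : 'I_n * 'I_n | (a.2 < a.1)%N && arrow_up G a.1 a.2].

(* The default value set0 is never used, see GsigmaP and Gsigma_unique. *)
Definition Gsigma (s : 'S_n) : graph n :=
  odflt set0 [pick G in Sigma | Qroots G == perm_roots s posroots].

End Sigma.

Definition is_nonneg_int (R : realType) (x : R[i]) : Prop :=
  exists m : nat, x = m%:R.
Definition is_pos_int (R : realType) (x : R[i]) : Prop :=
  exists m : nat, x = m.+1%:R.
Definition is_int (R : realType) (x : R[i]) : Prop :=
  exists m : int, x = m%:~R.

Notation tableau R n := {ffun vertex n -> R[i]}.

(* Tsigma_entry s X c d is the entry of T_s(X) in column c, d rows below the  *)
(* top row.                                                                   *)
Fixpoint Tsigma_entry (R : realType) (n : nat) (s : 'S_n) (X : 'rV[R[i]]_n)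
    (c : 'I_n) (d : nat) : R[i] :=
  if d is d'.+1 then
    let y := Tsigma_entry s X c d' in
    if arrow_up (Gsigma s) (n.-1 - d') c then y + 1 else y
  else X 0 (s^-1%g c).

Definition Tsigma (R : realType) (n : nat) (s : 'S_n) (X : 'rV[R[i]]_n) :
    tableau R n :=
  [ffun v => Tsigma_entry s X (vcol v) (n.-1 - vrow v)].

Definition wf_graph (n : nat) (G : graph n) : Prop :=
  (forall u v, arrow G u v ->
     [\/ vrow u = (vrow v).+1 :> nat, vrow v = (vrow u).+1 :> nat
       | is_top u /\ is_top v])
  /\ (forall u v, arrow G u v -> ~~ reach G v u).

Definition noncritical (n : nat) (G : graph n) : Prop :=
  forall u v : vertex n, vrow u = vrow v -> ~~ is_top u ->
    same_component G u v -> reach G u v || reach G v u.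

Definition satisfies (R : realType) (n : nat) (G : graph n) (L : tableau R n) :
    Prop :=
  forall u v, arrow G u v ->
    if (vrow u < vrow v)%N then is_pos_int (L u - L v)
    else is_nonneg_int (L u - L v).

Definition realization (R : realType) (n : nat) (G : graph n)
    (L : tableau R n) : Prop :=
  satisfies G L /\
  forall u v : vertex n, vrow u = vrow v -> ~~ is_top u ->
    is_int (L u - L v) -> same_component G u v.

Definition int_shift (R : realType) (n : nat) (L M : tableau R n) : Prop :=
  exists z : vertex n -> int,
    (forall v, is_top v -> z v = 0) /\ (forall v, M v = L v + (z v)%:~R).

Notation basis G L := {M | `[< realization G M /\ int_shift L M >]}.

(* Finitely supported functions basis G L -> R[i]. *)
Definition VG (R : realType) (n : nat) (G : graph n) (L : tableau R n) :
    lmodType R[i] :=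
  {malg R[i][basis G L]}.

(* The value 0 when M is not a basis element implements the convention that   *)
(* summands whose tableau is not a G-realization vanish.                      *)
Definition tabvec (R : realType) (n : nat) (G : graph n) (L M : tableau R n) :
    VG G L :=
  if insub M is Some b then mkmalgU (b : basis G L) 1 else 0.

Definition tab_add (R : realType) (n : nat) (M : tableau R n) (v : vertex n)
    (x : R[i]) : tableau R n :=
  [ffun w => if w == v then M w + x else M w].

Definition coef_den (R : realType) (n : nat) (M : tableau R n) (v : vertex n) :
    R[i] :=
  \prod_(w | (vrow w == vrow v) && (w != v)) (M v - M w).

Definition coef_raise (R : realType) (n : nat) (M : tableau R n)
    (v : vertex n) : R[i] :=
  (\prod_(w | vrow w == (vrow v).+1 :> nat) (M v - M w)) / coef_den M v.

Definition coef_lower (R : realType) (n : nat) (M : tableau R n)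
    (v : vertex n) : R[i] :=
  (\prod_(w | (vrow w).+1 == vrow v :> nat) (M v - M w)) / coef_den M v.

Definition GT_weight (R : realType) (n : nat) (M : tableau R n) (k : 'I_n) :
    R[i] :=
  k%:R + \sum_(v | vrow v == k) M v - \sum_(v | (vrow v).+1 == k :> nat) M v.

Definition gl_module (R : realType) (n : nat) (M : lmodType R[i])
    (rho : 'M[R[i]]_n -> M -> M) : Prop :=
  [/\ forall A, linear (rho A),
      forall x, linear (rho^~ x)
    & forall A B x,
        rho (A *m B - B *m A) x = rho A (rho B x) - rho B (rho A x)].

Definition GT_formulas (R : realType) (n : nat) (G : graph n)
    (L : tableau R n) (rho : 'M[R[i]]_n -> VG G L -> VG G L) : Prop :=
  forall b : basis G L, let M := val b in
  [/\ forall k k' : 'I_n, k' = k.+1 :> nat ->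
        rho (delta_mx k k') (tabvec G L M)
        = - \sum_(v | vrow v == k)
              coef_raise M v *: tabvec G L (tab_add M v 1),
      forall k k' : 'I_n, k' = k.+1 :> nat ->
        rho (delta_mx k' k) (tabvec G L M)
        = \sum_(v | vrow v == k)
              coef_lower M v *: tabvec G L (tab_add M v (-1))
    & forall k : 'I_n,
        rho (delta_mx k k) (tabvec G L M) = GT_weight M k *: tabvec G L M].

(* The formulas prescribe the action of a generating set of gl_n, so there is *)
(* at most one such rho for given G and L.                                    *)
Definition GT_module (R : realType) (n : nat) (G : graph n)
    (L : tableau R n) (rho : 'M[R[i]]_n -> VG G L -> VG G L) : Prop :=
  gl_module rho /\ GT_formulas rho.

Definition relation_graph (R : realType) (n : nat) (G : graph n) : Prop :=
  [/\ wf_graph G, noncritical G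
    & forall L : tableau R n, realization G L ->
        exists rho : 'M[R[i]]_n -> VG G L -> VG G L, GT_module rho].

Definition pregraph (R : realType) (n : nat) (L : tableau R n) : graph n :=
  [set e : vertex n * vertex n | let u := e.1 in let v := e.2 in
    `[< [\/ vrow u = (vrow v).+1 :> nat /\ is_nonneg_int (L u - L v),
            vrow v = (vrow u).+1 :> nat /\ is_pos_int (L u - L v)
          | [/\ is_top u /\ is_top v, u <> v, is_nonneg_int (L u - L v)
              & L u = L v -> (vcol u < vcol v)%N]] >]].

Definition same_reach (n : nat) (G H : graph n) : bool :=
  [forall u, forall v, reach H u v == reach G u v].

Definition transitive_reduction (n : nat) (G H : graph n) : bool :=
  minset (same_reach G) H.

(* The default value set0 is never used, see tableau_graphP and               *)
(* tableau_graph_unique.                                                      *)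
Definition tableau_graph (R : realType) (n : nat) (L : tableau R n) : graph n :=
  odflt set0 [pick H | transitive_reduction (pregraph L) H].

Definition highest_weight_vector (R : realType) (n : nat) (M : lmodType R[i])
    (rho : 'M[R[i]]_n -> M -> M) (s : 'S_n) (lam : 'rV[R[i]]_n) (x : M) : Prop :=
  [/\ x <> 0,
      forall i, rho (delta_mx (s i) (s i)) x = lam 0 i *: x
    & forall i j : 'I_n, (i < j)%N -> rho (delta_mx (s i) (s j)) x = 0].

Definition submodule (R : realType) (n : nat) (M : lmodType R[i])
    (rho : 'M[R[i]]_n -> M -> M) (W : M -> Prop) : Prop :=
  [/\ W 0,
      forall (a : R[i]) x y, W x -> W y -> W (a *: x + y)
    & forall A x, W x -> W (rho A x)].

Definition generated_by (R : realType) (n : nat) (M : lmodType R[i])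
    (rho : 'M[R[i]]_n -> M -> M) (x : M) : Prop :=
  forall W : M -> Prop, submodule rho W -> W x -> forall y, W y.

Definition highest_weight_module (R : realType) (n : nat) (M : lmodType R[i])
    (rho : 'M[R[i]]_n -> M -> M) (s : 'S_n) (lam : 'rV[R[i]]_n) : Prop :=
  exists x : M, highest_weight_vector rho s lam x /\ generated_by rho x.

Definition lambda_bar (R : realType) (n : nat) (lam : 'rV[R[i]]_n) :
    'rV[R[i]]_n :=
  \row_i (lam 0 i - i%:R).

Section GsigmaSpec.
Variable n : nat.

Lemma vertex_inj (u v : vertex n) :
  vrow u = vrow v :> nat -> vcol u = vcol v :> nat -> u = v.
Proof.
move=> /ord_inj hr /ord_inj hc; apply: val_inj.
by move: hr hc; rewrite /vrow /vcol; case: (val u) (val v) => [a b] [c d] /= -> ->.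
Qed.

Lemma has_arrowE (G : graph n) (u v : vertex n) :
  has_arrow G (vrow u : nat, vcol u : nat) (vrow v : nat, vcol v : nat)
  = arrow G u v.
Proof.
apply/existsP/idP => [[[u' v'] /and5P[/= uvG]]|uvG]; last first.
  by exists (u, v); rewrite /= !eqxx !andbT.
move=> /eqP h1 /eqP h2 /eqP h3 /eqP h4.
by rewrite /arrow -(vertex_inj h1 h2) -(vertex_inj h3 h4).
Qed.

Lemma arrow_downE (G : graph n) (u v : vertex n) :
  vcol u = vcol v -> vrow u = (vrow v).+1 :> nat ->
  arrow_down G (vrow u) (vcol u) = arrow G u v.
Proof. by move=> hc hr; rewrite -has_arrowE /arrow_down hc hr. Qed.

Lemma arrow_upE (G : graph n) (u v : vertex n) :
  vcol u = vcol v -> vrow u = (vrow v).+1 :> nat ->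
  arrow_up G (vrow u) (vcol u) = arrow G v u.
Proof. by move=> hc hr; rewrite -has_arrowE /arrow_up hc hr. Qed.

Lemma vertex_pair (r c : 'I_n) : (c < r)%N ->
  exists u v : vertex n,
    [/\ vrow u = r, vcol u = c, vcol v = c & vrow u = (vrow v).+1 :> nat].
Proof.
move=> cr; have r0 : (0 < r)%N by apply: leq_ltn_trans cr.
have hr : (r.-1 < n)%N by apply: leq_ltn_trans (leq_pred _) _.
have h1 : ((r, c).2 <= (r, c).1)%N by apply: ltnW.
have h2 : ((Ordinal hr, c).2 <= (Ordinal hr, c).1)%N by rewrite /= -ltnS prednK.
exists (exist _ (r, c) h1), (exist _ (Ordinal hr, c) h2).
by split=> //=; rewrite /vrow /= prednK.
Qed.

Lemma perm_posrootsE (s : 'S_n) (i j : 'I_n) :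
  ((i, j) \in perm_roots s (posroots n)) = (s^-1%g i < s^-1%g j)%N.
Proof.
apply/imsetP/idP => [[[a b]]|h].
  by rewrite inE /= => ab [-> ->]; rewrite !permK.
by exists (s^-1%g i, s^-1%g j); rewrite ?inE //= !permKV.
Qed.

Lemma Sigma_arrow (G : graph n) (u v : vertex n) (s : 'S_n) :
  G \in Sigma n -> Qroots G = perm_roots s (posroots n) ->
  arrow G u v = (vcol u == vcol v) &&
    ((vrow u == (vrow v).+1 :> nat) && (s^-1%g (vcol u) < s^-1%g (vrow u))%N
  || (vrow v == (vrow u).+1 :> nat) && (s^-1%g (vrow v) < s^-1%g (vcol v))%N).
Proof.
rewrite inE => /andP[/forallP hex /forall_inP honly] hQ.
case: (boolP ((vcol u == vcol v) && ((vrow u == (vrow v).+1 :> nat)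
   || (vrow v == (vrow u).+1 :> nat)))) => [/andP[/eqP hc hr]|hn]; last first.
  apply/idP/idP => [/honly/= h|]; first by rewrite h in hn.
  move=> /andP[hc /orP[]/andP[hr _]]; move: hn; by rewrite hc hr ?orbT.
rewrite hc eqxx /=.
have key (x y : vertex n) : vcol x = vcol y -> vrow x = (vrow y).+1 :> nat ->
  arrow G x y = (s^-1%g (vcol x) < s^-1%g (vrow x))%N /\
  arrow G y x = (s^-1%g (vrow x) < s^-1%g (vcol x))%N.
  move=> hcxy hrxy.
  have hlt : (vcol x < vrow x)%N.
    by rewrite hrxy ltnS hcxy; exact: (valP y).
  rewrite -!perm_posrootsE -hQ !inE /= hlt (ltnNge (vrow x)) (ltnW hlt) /=.
  by rewrite (arrow_downE _ hcxy hrxy) (arrow_upE _ hcxy hrxy) orbF.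
case/orP: hr => /eqP hr.
  have [-> _] := key _ _ hc hr.
  by rewrite hr eqxx -hc ltn_eqF ?orbF // ltnS leqnSn.
have [_ ->] := key _ _ (esym hc) hr.
by rewrite hr eqxx ltn_eqF //= ?ltnS ?leqnSn.
Qed.

Lemma Gsigma_spec_ex (s : 'S_n) : exists G : graph n,
  G \in Sigma n /\ Qroots G = perm_roots s (posroots n).
Proof.
pose G : graph n := [set e | (vcol e.1 == vcol e.2) &&
    ((vrow e.1 == (vrow e.2).+1 :> nat)
       && (s^-1%g (vcol e.1) < s^-1%g (vrow e.1))%N
  || (vrow e.2 == (vrow e.1).+1 :> nat)
       && (s^-1%g (vrow e.2) < s^-1%g (vcol e.2))%N)].
have GE (r c : 'I_n) : (c < r)%N ->
    arrow_down G r c = (s^-1%g c < s^-1%g r)%N /\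
    arrow_up G r c = (s^-1%g r < s^-1%g c)%N.
  move=> /vertex_pair[u [v [<- <- hc hr]]].
  rewrite (arrow_downE _ (esym hc) hr) (arrow_upE _ (esym hc) hr) /arrow !inE /=.
  by rewrite hc hr !eqxx /= [_ == _.+2]ltn_eqF ?orbF.
exists G; split.
  rewrite inE; apply/andP; split; last first.
    apply/forall_inP => e; rewrite inE => /andP[-> /=].
    by case/orP=> /andP[-> _]; rewrite ?orbT.
  apply/forallP => r; apply/forallP => c; apply/implyP => cr.
  have [-> ->] := GE _ _ cr.
  case: ltngtP => // /ord_inj/perm_inj h; by rewrite h ltnn in cr.
apply/setP => -[i j]; rewrite perm_posrootsE !inE /=.
case: (ltngtP i j) => [ij|ji|/ord_inj ->] /=; last by rewrite ltnn.
  by rewrite orbF; have [-> _] := GE _ _ ij.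
by have [_ ->] := GE _ _ ji.
Qed.

Lemma GsigmaP (s : 'S_n) :
  Gsigma s \in Sigma n /\ Qroots (Gsigma s) = perm_roots s (posroots n).
Proof.
rewrite /Gsigma; case: pickP => [G /andP[? /eqP ?] //|h].
by have [G [h1 h2]] := Gsigma_spec_ex s; have := h G; rewrite h1 h2 eqxx.
Qed.

Lemma Gsigma_unique (s : 'S_n) (G : graph n) :
  G \in Sigma n -> Qroots G = perm_roots s (posroots n) -> G = Gsigma s.
Proof.
move=> h1 h2; have [h3 h4] := GsigmaP s; apply/setP => -[u v].
exact: etrans (Sigma_arrow u v h1 h2) (esym (Sigma_arrow u v h3 h4)).
Qed.

End GsigmaSpec.

Lemma Tsigma_top (R : realType) (n : nat) (s : 'S_n) (X : 'rV[R[i]]_n)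
    (v : vertex n) : is_top v -> Tsigma s X v = X 0 (s^-1%g (vcol v)).
Proof.
move=> /eqP h; rewrite ffunE (_ : (n.-1 - vrow v)%N = 0%N) //.
by apply/eqP; rewrite subn_eq0 -ltnS prednK ?h // -h.
Qed.

Lemma Tsigma_rec (R : realType) (n : nat) (s : 'S_n) (X : 'rV[R[i]]_n)
    (u v : vertex n) : vcol u = vcol v -> vrow u = (vrow v).+1 :> nat ->
  (arrow (Gsigma s) u v -> Tsigma s X v = Tsigma s X u) /\
  (arrow (Gsigma s) v u -> Tsigma s X v = Tsigma s X u + 1).
Proof.
move=> hc hr; have hu := ltn_ord (vrow u).
have hu' : (vrow u <= n.-1)%N by rewrite -ltnS prednK // (leq_trans _ hu).
have e1 : (n.-1 - vrow v)%N = (n.-1 - vrow u).+1.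
  by rewrite hr subnS prednK // subn_gt0 -hr.
have e2 : (n.-1 - (n.-1 - vrow u))%N = vrow u by rewrite subKn.
rewrite [Tsigma s X v]ffunE e1 /= e2 -hc (arrow_upE _ hc hr) ffunE.
have [hS hQ] := GsigmaP s.
split=> h; last by rewrite h.
have -> : arrow (Gsigma s) v u = false; last by [].
apply/negbTE/negP => h'; move: hS; rewrite inE => /andP[/forallP /(_ (vrow u))].
move=> /forallP /(_ (vcol u)) + _; rewrite {1}hr ltnS {1}hc (valP v) /=.
by rewrite (arrow_downE _ hc hr) (arrow_upE _ hc hr) h h'.
Qed.

Lemma tableau_graphP (R : realType) (n : nat) (L : tableau R n) :
  transitive_reduction (pregraph L) (tableau_graph L).
Proof.
rewrite /tableau_graph; case: pickP => //= h.
have p0 : same_reach (pregraph L) (pregraph L).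
  by apply/forallP => u; apply/forallP.
have [H hH _] := minset_exists p0.
by have := h H; rewrite /transitive_reduction hH.
Qed.

Section ReductionUnique.
Variable n : nat.

Lemma reach_avoid (H : graph n) (e a b : _) :
  reach H a b -> ~~ (reach H a e.1 && reach H e.2 b) -> reach (H :\ e) a b.
Proof.
move=> /connectP[p]; elim: p a => [|x p IH] a /=.
  by move=> _ -> _; apply: connect0.
move=> /andP[ax xp] bE hne.
have xb : reach H x b by apply/connectP; exists p.
have ax' : arrow (H :\ e) a x.
  rewrite /arrow !inE (ax : (a, x) \in H) andbT.
  apply: contra hne => /eqP <-; by rewrite /= xb /reach connect0.
apply: connect_trans (connect1 ax') _; apply: IH => //.
apply: contra hne => /andP[xe ->]; rewrite andbT.
exact: connect_trans (connect1 ax) xe.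
Qed.

Lemma reach_del (H : graph n) (e : vertex n * vertex n) :
  reach (H :\ e) e.1 e.2 -> reach (H :\ e) =2 reach H.
Proof.
move=> he a b; apply/idP/idP.
  by apply: connect_sub => x y; rewrite /arrow inE => /andP[_ h]; apply: connect1.
apply: connect_sub => x y xy; case: (eqVneq (x, y) e) => [eE|ne].
  by move: he; rewrite -eE.
by apply: connect1; rewrite /arrow !inE ne.
Qed.

Lemma reduction_unique (G H1 H2 : graph n) :
  (forall u v, reach G u v -> reach G v u -> u = v) ->
  transitive_reduction G H1 -> transitive_reduction G H2 -> H1 = H2.
Proof.
move=> anti; wlog suff sub : H1 H2 / transitive_reduction G H1 ->
    transitive_reduction G H2 -> H1 \subset H2.
  by move=> h1 h2; apply/eqP; rewrite eqEsubset !sub.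
move=> /minsetP[s1 m1] /minsetP[s2 _].
have r1 u v : reach H1 u v = reach G u v.
  by move/forallP: s1 => /(_ u)/forallP/(_ v)/eqP.
have r2 u v : reach H2 u v = reach G u v.
  by move/forallP: s2 => /(_ u)/forallP/(_ v)/eqP.
apply/subsetP => -[u v] uv1; apply/negPn/negP => uv2.
suff h : reach (H1 :\ (u, v)) u v.
  have /setP/(_ (u, v)) : H1 :\ (u, v) = H1.
    apply: m1; last exact: subD1set.
    apply/forallP => a; apply/forallP => b; rewrite -r1; apply/eqP.
    exact: (reach_del (e := (u, v))).
  by rewrite !inE eqxx uv1.
have [<-|neuv] := eqVneq u v; first exact: connect0.
have : reach H2 u v by rewrite r2 -r1; apply: connect1.
move=> /connectP[p0 hp0 vE]; case: (shortenP hp0) vE => -[|x p] /=.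
  by move=> _ _ _ e; rewrite e eqxx in neuv.
move=> /andP[ux xp] /and3P[unx _ _] _ vE.
have xu : x != u by apply: contra unx => /eqP ->; rewrite inE eqxx.
have xv : x != v by apply: contraNneq uv2 => <-.
have gux : reach G u x by rewrite -r2; apply: connect1.
have gxv : reach G x v by rewrite -r2; apply/connectP; exists p.
apply: (@connect_trans _ _ x).
  apply: (@reach_avoid H1 (u, v)); rewrite /= ?r1 //; apply/negP => /andP[_ vx].
  by rewrite (anti _ _ gxv vx) eqxx in xv.
apply: (@reach_avoid H1 (u, v)); rewrite /= ?r1 //; apply/negP => /andP[xu' _].
by rewrite (anti _ _ gux xu') eqxx in xu.
Qed.

Lemma pregraph_anti (R : realType) (L : tableau R n) (u v : vertex n) :
  reach (pregraph L) u v -> reach (pregraph L) v u -> u = v.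
Proof.
pose f (u : vertex n) := ((n - vrow u) * n + vcol u)%N.
pose P u v := exists m : nat, L u - L v = m%:R /\ (m = 0%N -> (f u < f v)%N).
have arrP x y : arrow (pregraph L) x y -> P x y.
  rewrite /arrow inE => /asboolP /= [[hr [m hm]]|[hr [m hm]]|].
  - exists m; split=> // _; rewrite /f hr.
    have hy : ((vrow y).+1 < n)%N by rewrite -hr.
    rewrite -(subnSK (ltnW hy)) mulSn -addnA addnCA ltn_add2l.
    by rewrite ltn_addr // ltn_ord.
  - by exists m.+1.
  - move=> [[/eqP tx /eqP ty] _ [m hm] hlt]; exists m; split=> // m0.
    have hrow : vrow x = vrow y :> nat by apply: succn_inj; rewrite tx ty.
    rewrite /f hrow ltn_add2l; apply: hlt.
    by apply/eqP; rewrite -subr_eq0 hm m0.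
have Ptrans x y z : P x y -> P y z -> P x z.
  move=> [m [hm fm]] [k [hk fk]]; exists (m + k)%N; split.
    by rewrite natrD -hm -hk addrA subrK.
  by move=> /eqP; rewrite addn_eq0 => /andP[/eqP/fm h /eqP/fk]; apply: ltn_trans.
have Pirr x : ~ P x x.
  move=> [m []]; rewrite subrr => /esym/eqP; rewrite pnatr_eq0 => /eqP -> h.
  by have := h erefl; rewrite ltnn.
have reachP x y : reach (pregraph L) x y -> x = y \/ P x y.
  move=> /connectP[p]; elim: p x => [|z p IH] x /=; first by move=> _ ->; left.
  move=> /andP[/arrP xz zp] yE; right.
  by case: (IH _ zp yE) => [<-//|]; apply: Ptrans.
move=> /reachP[//|uv] /reachP[//|vu]; by case: (Pirr u); apply: Ptrans vu.
Qed.

End ReductionUnique.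

Lemma tableau_graph_unique (R : realType) (n : nat) (L : tableau R n)
    (H : graph n) :
  transitive_reduction (pregraph L) H -> H = tableau_graph L.
Proof.
move=> h; apply: reduction_unique h (tableau_graphP L) => u v.
exact: pregraph_anti.
Qed.

(* Main.v *)
(* Write P for the graph before transitive reduction. A tableau T + z is a basis
   vector of V_G(T) iff it satisfies all relations of P; noncriticality makes the
   entries of each row below the top one pairwise distinct, and between two basis
   tableaux differing by one unit in one entry all coefficients are nonzero.

   T generates V_G(T): let W be a submodule containing a basis tableau M. Applying
   E_{k,k+1} gives a combination of the M + delta^{ku}, u in row k, and these
   summands have to be split. Suppose that some diagonal operator built from the
   action separates them. Then E' : M |-> - sum_u M_u a_u (M + delta^{ku}), where
   - a_u are the coefficients of E_{k,k+1}, is also built from the action, and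
   [E', E_{k+1,k}] is again diagonal. Its eigenvalue is a second moment; the first
   moment is known from [E_{k,k+1}, E_{k+1,k}] = E_{kk} - E_{k+1,k+1}. As both are
   affine in each entry of row k + 1, the first moment determines how the second
   one changes when the entry M_w of row k + 1 grows by one: by c(M) - M_w. So row
   k + 1 is separated too. Finally any basis tableau is joined to T by unit steps,
   each moving an entry that is extremal for the order given by P.

   T is a highest weight vector: if T + z is a basis tableau, the column relations
   and Abel summation give sum_k s^-1(k) (w_k(T + z) - w_k(T)) >= 0, whereas
   E_{s(i) s(j)} T with i < j has weights for which this sum is i - j < 0. *)
Require Import Defs.
From HB Require Import structures.
From mathcomp Require Import all_boot all_order all_algebra all_fingroup.
From mathcomp Require Import boolp reals.
From mathcomp Require Import finmap complex monalg.
From mathcomp Require Import ring zify.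

Set Implicit Arguments.
Unset Strict Implicit.
Unset Printing Implicit Defensive.

Import Order.TTheory GRing.Theory Num.Theory.

Local Open Scope ring_scope.

(** * Integral differences of complex numbers *)

Section Integers.
Variable R : realType.
Implicit Types x y : R[i].

Lemma is_intD x y : is_int x -> is_int y -> is_int (x + y).
Proof. by move=> [a ->] [b ->]; exists (a + b); rewrite intrD. Qed.

Lemma is_intN x : is_int x -> is_int (- x).
Proof. by move=> [a ->]; exists (- a); rewrite intrN. Qed.

Lemma is_int_sym x y : is_int (x - y) -> is_int (y - x).
Proof. by move=> /is_intN; rewrite opprB. Qed.

Lemma is_int_nat (m : nat) : is_int (m%:R : R[i]).
Proof. by exists m. Qed.

Lemma is_int_dichotomy x y :
  is_int (x - y) -> is_nonneg_int (x - y) \/ is_pos_int (y - x).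
Proof.
move=> [[m|m] xy]; [left|right]; exists m; first by rewrite xy.
by rewrite -opprB xy NegzE intrN opprK.
Qed.

Lemma nonneg_int_neqN1 : ~ is_nonneg_int (-1 : R[i]).
Proof.
move=> [m /eqP]; rewrite eq_sym -subr_eq0 opprK natr1.
by rewrite pnatr_eq0.
Qed.

Lemma pos_int_neq0 : ~ is_pos_int (0 : R[i]).
Proof. by move=> [m /esym/eqP]; rewrite pnatr_eq0. Qed.

Lemma nonneg_int_neq0 x : is_nonneg_int x -> x <> 0 -> is_nonneg_int (x - 1).
Proof. by move=> [[|m] ->] // _; exists m; rewrite -addn1 natrD addrK. Qed.

Lemma pos_int_neq1 x : is_pos_int x -> x <> 1 -> is_pos_int (x - 1).
Proof. by move=> [[|m] ->] // _; exists m; rewrite -addn1 natrD addrK. Qed.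

Lemma nonneg_intS x : is_nonneg_int x -> is_nonneg_int (x + 1).
Proof. by move=> [m ->]; exists m.+1; rewrite natr1. Qed.

Lemma pos_intS x : is_pos_int x -> is_pos_int (x + 1).
Proof. by move=> [m ->]; exists m.+1; rewrite natr1. Qed.

End Integers.

Lemma top_row (n : nat) (u v : vertex n) : is_top u -> is_top v -> vrow u = vrow v.
Proof. by move=> /eqP hu /eqP hv; apply/val_inj/succn_inj; rewrite hu hv. Qed.

Lemma eq_row_top (n : nat) (u v : vertex n) : vrow u = vrow v -> is_top u = is_top v.
Proof. by rewrite /is_top => ->. Qed.

(** * The graph of a tableau before and after transitive reduction *)

Section TableauGraph.
Variables (R : realType) (n : nat) (T : tableau R n).
Local Notation P := (pregraph T).
Local Notation G := (tableau_graph T).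

Lemma arrow_pregraph u v : arrow P u v ->
  [\/ vrow u = (vrow v).+1 :> nat /\ is_nonneg_int (T u - T v),
      vrow v = (vrow u).+1 :> nat /\ is_pos_int (T u - T v)
    | [/\ is_top u /\ is_top v, u <> v, is_nonneg_int (T u - T v)
        & T u = T v -> (vcol u < vcol v)%N]].
Proof. by rewrite /arrow inE => /asboolP. Qed.

Lemma arrow_down_pregraph u v : vrow u = (vrow v).+1 :> nat ->
  is_nonneg_int (T u - T v) -> arrow P u v.
Proof. by move=> h1 h2; rewrite /arrow inE; apply/asboolP; constructor 1. Qed.

Lemma arrow_up_pregraph u v : vrow v = (vrow u).+1 :> nat ->
  is_pos_int (T u - T v) -> arrow P u v.
Proof. by move=> h1 h2; rewrite /arrow inE; apply/asboolP; constructor 2. Qed.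

Lemma arrow_pregraph_neq u v : arrow P u v -> u <> v.
Proof.
move=> /arrow_pregraph[[h _]|[h _]|[]//] uv; move: h; rewrite uv => /eqP.
  by rewrite ltn_eqF.
by rewrite ltn_eqF.
Qed.

Lemma satisfies_pregraph : satisfies P T.
Proof.
move=> u v /arrow_pregraph[[-> h]|[-> h]|[[tu tv] _ h _]].
- by rewrite ltnNge leqnSn.
- by rewrite leqnn.
- by rewrite (top_row tu tv) ltnn.
Qed.

(** Some minimal graph with the reachability of [P] lies inside [P], and the transitive reduction is
    unique. *)
Lemma tableau_graph_sub : G \subset P.
Proof.
have p0 : same_reach P P by apply/forallP => u; apply/forallP.
by have [H /tableau_graph_unique <-] := minset_exists p0.
Qed.

Lemma reach_tableau_graph u v : reach G u v = reach P u v.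
Proof.
have /minsetP[/forallP h _] := tableau_graphP T.
by have /forallP/(_ v)/eqP := h u.
Qed.

Lemma arrow_tableau_graph u v : arrow G u v -> arrow P u v.
Proof. by move/(subsetP tableau_graph_sub). Qed.

Lemma same_component_sym (H : graph n) u v :
  same_component H u v = same_component H v u.
Proof. by apply: sym_connect_sym => x y /=; rewrite orbC. Qed.

Lemma arrow_same_component u v : arrow P u v -> same_component G u v.
Proof.
move=> /(@connect1 _ (arrow P)); rewrite -/(reach P u v) -reach_tableau_graph.
by apply: connect_sub => x y xy; apply: connect1; rewrite /= xy.
Qed.

Lemma int_adjacent_same_component u v : vrow u = (vrow v).+1 :> nat ->
  is_int (T u - T v) -> same_component G u v.
Proof.
move=> hr /is_int_dichotomy[h|h]; last rewrite same_component_sym.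
  exact/arrow_same_component/arrow_down_pregraph.
exact/arrow_same_component/arrow_up_pregraph.
Qed.

(** [P] joins two vertices of consecutive rows, in one direction or the other, as soon as their
    entries differ by an integer. Hence a vertex [w] above [u] at integral distance connects [u]
    with every [v] of its row at integral distance. *)
Lemma tableau_graph_realization :
  (forall u, ~~ is_top u ->
     exists2 w, vrow w = (vrow u).+1 :> nat & is_int (T w - T u)) ->
  realization G T.
Proof.
move=> up; split=> [u v /arrow_tableau_graph/satisfies_pregraph//|u v uv tu hi].
have [w wu hw] := up u tu.
apply: (@connect_trans _ _ w).
  rewrite -/(same_component G u w) same_component_sym.
  exact: int_adjacent_same_component.
apply: int_adjacent_same_component; first by rewrite -uv.
by have := is_intD hw hi; rewrite addrA subrK.
Qed.

End TableauGraph.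

(* A path that keeps the value constant has only down or top-row arrows. *)
Lemma satisfies_reach (R : realType) (n : nat) (H : graph n) (M : tableau R n)
    (u v : vertex n) :
  wf_graph H -> satisfies H M -> reach H u v ->
  exists m : nat, M u - M v = m%:R /\ (m = 0 ->
    (vrow v <= vrow u)%N /\ (vrow u = vrow v -> u = v \/ is_top u)).
Proof.
move=> [wf _] sat /connectP[p]; elim: p u => [|x p IH] u /=.
  by move=> _ ->; exists 0%N; rewrite subrr; split=> // _; split=> // _; left.
move=> /andP[ux xp] vE; have [m [hm h0]] := IH _ xp vE.
have := sat _ _ ux; case: ltnP => [lt [m' hm']|le [m' hm']].
  exists (m'.+1 + m)%N; split=> //.
  by rewrite natrD -hm -hm' addrA subrK.
exists (m' + m)%N; split; first by rewrite natrD -hm -hm' addrA subrK.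
move=> /eqP; rewrite addn_eq0 => /andP[_ /eqP/h0[le1 _]].
split; first exact: leq_trans le1 le.
move=> uv; right; case: (wf _ _ ux) => [ux'|ux'|[]//].
  by move: le1; rewrite -uv ux' ltnn.
by move: le; rewrite ux' ltnn.
Qed.

(** * Basis tableaux and their unit moves *)

Definition in_basis (R : realType) (n : nat) (T M : tableau R n) : Prop :=
  realization (tableau_graph T) M /\ int_shift T M.

Section Basis.
Variables (R : realType) (n : nat) (T : tableau R n).
Local Notation P := (pregraph T).
Local Notation G := (tableau_graph T).
Hypothesis (wfG : wf_graph G) (ncG : noncritical G) (realT : realization G T).
Implicit Types (M N : tableau R n) (u v w : vertex n).

Lemma tab_addE M v e w : tab_add M v e w = M w + (if w == v then e else 0).
Proof. by rewrite ffunE; case: eqP; rewrite ?addr0. Qed.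

Lemma tab_addC M u v e d :
  tab_add (tab_add M u e) v d = tab_add (tab_add M v d) u e.
Proof. by apply/ffunP => w; rewrite !tab_addE addrAC. Qed.

Lemma tab_addK M v e : tab_add (tab_add M v e) v (- e) = M.
Proof.
by apply/ffunP => w; rewrite !tab_addE; case: eqP; rewrite ?addr0 ?addrK.
Qed.

Lemma tab_addNK M v e : tab_add (tab_add M v (- e)) v e = M.
Proof. by rewrite -{2}[e]opprK tab_addK. Qed.

(** An arrow of [P] lost in the reduction is still a path of [G], and differences add up along it.
    For an upward arrow the total is nonzero, since a path of constant value never climbs. *)
Lemma realization_pregraph M : realization G M -> satisfies P M.
Proof.
move=> [sat _] u v /(@connect1 _ (arrow P)); rewrite -/(reach P u v).
rewrite -reach_tableau_graph => /(satisfies_reach wfG sat)[m [-> h0]].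
case: ltnP => [lt|_]; last by exists m.
case: m h0 => [[]//|m _]; last by exists m.
by rewrite leqNgt lt.
Qed.

Lemma int_shiftB M u v : int_shift T M -> is_int ((M u - M v) - (T u - T v)).
Proof.
move=> [z [_ hz]]; exists (z u - z v); rewrite !hz intrB; ring.
Qed.

(** Integral shifts preserve integrality of differences, so the component condition is inherited
    from [T] and only the arrows need checking. *)
Lemma in_basisP M : int_shift T M -> satisfies P M -> in_basis T M.
Proof.
move=> hM sat; split=> //; split=> [u v /arrow_tableau_graph/sat//|u v uv tu hi].
apply: realT.2 => //.
have := is_intD hi (is_intN (int_shiftB u v hM)).
by rewrite opprB addrCA subrr addr0.
Qed.

Lemma in_basis_sat M : in_basis T M -> satisfies P M.
Proof. by move=> [/realization_pregraph]. Qed.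

Lemma in_basis_T : in_basis T T.
Proof.
split=> //; exists (fun=> 0); split=> // v; by rewrite addr0.
Qed.

(** Equal entries force a common component, so noncriticality yields an oriented path of constant
    value; such a path cannot join distinct vertices of a row below the top. *)
Lemma in_basis_row_neq M u v : in_basis T M ->
  vrow u = vrow v -> ~~ is_top u -> u != v -> M u - M v != 0.
Proof.
move=> [[sat hc] _] uv tu neuv; apply/negP => /eqP Muv.
have key x y : vrow x = vrow y -> ~~ is_top x -> x <> y -> M x - M y = 0 ->
    ~ reach G x y.
  move=> xy tx nexy Mxy /(satisfies_reach wfG sat)[m [hm h0]].
  move: hm; rewrite Mxy => /esym/eqP; rewrite pnatr_eq0 => /eqP/h0[_ /(_ xy)].
  by case=> [//|]; apply/negP.
have /(ncG uv tu)/orP[|] : same_component G u v.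
  by apply: hc => //; rewrite Muv; apply: (is_int_nat _ 0).
  by apply: key => //; apply/eqP.
apply: key => //; first by rewrite -(eq_row_top uv).
  by apply/eqP; rewrite eq_sym.
by rewrite -opprB Muv oppr0.
Qed.

Lemma int_shift_add M v e : ~~ is_top v -> int_shift T M -> is_int e ->
  int_shift T (tab_add M v e).
Proof.
move=> tv [z [z0 hz]] [d ->]; exists (fun w => z w + if w == v then d else 0).
split=> w; last by rewrite tab_addE hz intrD addrA; case: eqP.
by move=> tw; rewrite z0 //; case: eqP tw tv => // -> ->.
Qed.

Lemma in_basis_shift_nontop M v e :
  in_basis T M -> in_basis T (tab_add M v e) -> e <> 0 -> ~~ is_top v.
Proof.
move=> [_ [z [z0 hz]]] [_ [y [y0 hy]]] e0; apply/negP => tv; apply: e0.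
move: (hy v) (hz v); rewrite tab_addE eqxx y0 // z0 // => hyv hzv.
by move: hyv; rewrite hzv !addr0 => /eqP; rewrite addrC -subr_eq0 addrK => /eqP.
Qed.

(** Raising can break only an arrow into [v], and only one whose inequality is sharp. The two
    alternatives exhibit a vanishing factor of [coef_raise M v] and of
    [coef_lower (tab_add M v 1) v] respectively. *)
Lemma raise_blocked M v : in_basis T M -> ~~ is_top v ->
  ~ in_basis T (tab_add M v 1) ->
  (exists w, [/\ arrow P w v, vrow w = (vrow v).+1 :> nat & M v - M w = 0]) \/
  (exists w, [/\ arrow P w v, (vrow w).+1 = vrow v :> nat & M v + 1 - M w = 0]).
Proof.
move=> bM tv nb; apply: contrapT => /not_orP[n1 n2]; apply: nb.
apply: in_basisP => [|x y xy].
  by apply: int_shift_add tv bM.2 (is_int_nat _ 1).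
have := in_basis_sat bM xy; rewrite !tab_addE.
have nexy := arrow_pregraph_neq xy.
have [xv|nx] := eqVneq x v; have [yv|ny] := eqVneq y v; rewrite ?addr0 //.
- by case: nexy; rewrite xv yv.
- by rewrite addrAC; case: ifP => _; [apply: pos_intS|apply: nonneg_intS].
- rewrite yv opprD addrA; rewrite yv {nexy yv} in xy.
  case: (arrow_pregraph xy) => [[hr _]|[hr _]|[[_ ty]]].
  + rewrite hr ltnNge leqnSn /= => h; apply: nonneg_int_neq0 h _ => h.
    by apply: n1; exists x; split; rewrite // -opprB h oppr0.
  + rewrite hr leqnn => h; apply: pos_int_neq1 h _ => h.
    by apply: n2; exists x; split; rewrite // -h; ring.
  + by rewrite ty in tv.
Qed.

(** Dual to [raise_blocked], with arrows out of [v]; the vanishing factors belong to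
    [coef_raise (tab_add M v (-1)) v] and [coef_lower M v]. *)
Lemma lower_blocked M v : in_basis T M -> ~~ is_top v ->
  ~ in_basis T (tab_add M v (-1)) ->
  (exists w, [/\ arrow P v w, vrow w = (vrow v).+1 :> nat & M v - 1 - M w = 0]) \/
  (exists w, [/\ arrow P v w, (vrow w).+1 = vrow v :> nat & M v - M w = 0]).
Proof.
move=> bM tv nb; apply: contrapT => /not_orP[n1 n2]; apply: nb.
apply: in_basisP => [|x y xy].
  by apply: int_shift_add tv bM.2 (is_intN (is_int_nat _ 1)).
have := in_basis_sat bM xy; rewrite !tab_addE.
have nexy := arrow_pregraph_neq xy.
have [xv|nx] := eqVneq x v; have [yv|ny] := eqVneq y v; rewrite ?addr0 //.
- by case: nexy; rewrite xv yv.
- rewrite xv addrAC; rewrite xv {nexy xv} in xy.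
  case: (arrow_pregraph xy) => [[hr _]|[hr _]|[[tx _]]].
  + rewrite hr ltnNge leqnSn /= => h; apply: nonneg_int_neq0 h _ => h.
    by apply: n2; exists y; split.
  + rewrite hr leqnn => h; apply: pos_int_neq1 h _ => h.
    by apply: n1; exists y; split; rewrite // addrAC h subrr.
  + by rewrite tx in tv.
- rewrite opprD opprK addrA.
  by case: ifP => _; [apply: pos_intS|apply: nonneg_intS].
Qed.

(** Equal entries make [T w - T v] integral, so [P] has an arrow between the two vertices. A
    downward one would break after raising [v]; an upward one is strict and already fails at [M]. *)
Lemma in_basis_adjacent_upper M v w : in_basis T M -> in_basis T (tab_add M v 1) ->
  vrow w = (vrow v).+1 :> nat -> M v - M w != 0.
Proof.
move=> bM bN hr; apply/eqP => Mvw.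
have wv : (w == v) = false by apply: contra_eqF hr => /eqP ->; rewrite ltn_eqF.
have : is_int (T w - T v).
  apply: is_int_sym; have := is_intN (int_shiftB v w bM.2).
  by rewrite Mvw sub0r opprK.
move=> /is_int_dichotomy[h|h].
  have := in_basis_sat bN (arrow_down_pregraph hr h).
  rewrite hr ltnNge leqnSn /= !tab_addE eqxx wv.
  rewrite addr0 opprD addrA -(opprB (M v)) Mvw oppr0 sub0r.
  exact: nonneg_int_neqN1.
have := in_basis_sat bM (arrow_up_pregraph hr h).
by rewrite hr leqnn Mvw => /pos_int_neq0.
Qed.

Lemma in_basis_adjacent_lower M v w : in_basis T M -> in_basis T (tab_add M v 1) ->
  (vrow w).+1 = vrow v :> nat -> M v + 1 - M w != 0.
Proof.
move=> bM bN hr; apply/eqP => Mvw.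
have wv : (w == v) = false by apply: contra_eqF hr => /eqP ->; rewrite gtn_eqF.
have : is_int (T v - T w).
  have := is_intD (is_intN (int_shiftB v w bM.2)) (is_intN (is_int_nat R 1)).
  rewrite (_ : _ + _ = T v - T w - (M v + 1 - M w)); last by ring.
  by rewrite Mvw subr0.
move=> /is_int_dichotomy[h|h].
  have := in_basis_sat bM (arrow_down_pregraph (esym hr) h).
  rewrite -hr ltnNge leqnSn /= -[M v](addrK 1) addrAC Mvw sub0r.
  exact: nonneg_int_neqN1.
have := in_basis_sat bN (arrow_up_pregraph (esym hr) h).
rewrite -hr leqnn !tab_addE eqxx wv addr0 -opprB Mvw oppr0.
exact: pos_int_neq0.
Qed.

(** No arrow joins [u] and [v], so each relation sees at most one of the two moves: after a single
    move it reads as it does in [M] or in the final tableau. *)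
Lemma in_basis_exchange M u v : in_basis T M -> vrow u = vrow v -> u != v ->
  ~~ is_top u -> in_basis T (tab_add (tab_add M u 1) v (-1)) ->
  in_basis T (tab_add M u 1) /\ in_basis T (tab_add M v (-1)).
Proof.
move=> bM uv neuv tu bN; have tv : ~~ is_top v by rewrite -(eq_row_top uv).
have sym : (v == u) = false by rewrite eq_sym (negbTE neuv).
have apart x y : arrow P x y -> (x == u) || (x == v) -> (y == u) || (y == v) -> False.
  move=> xy xuv yuv.
  have xu : vrow x = vrow u by case/orP: xuv => /eqP ->.
  have yu : vrow y = vrow u by case/orP: yuv => /eqP ->.
  case: (arrow_pregraph xy) => [[]|[]|[[tx _]]]; rewrite ?xu ?yu.
  - by move/eqP; rewrite ltn_eqF.
  - by move/eqP; rewrite ltn_eqF.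
  - by move: tu; rewrite -(eq_row_top xu) tx.
split; apply: in_basisP => [|x y xy].
- by apply: int_shift_add tu bM.2 (is_int_nat _ 1).
- have := in_basis_sat bM xy; have := in_basis_sat bN xy; rewrite !tab_addE.
  have := apart _ _ xy; have [->|_] := eqVneq x u; have [->|_] := eqVneq y u;
    rewrite ?(negbTE neuv) ?sym ?orbT ?orbF /= ?addr0 //.
  + by case: eqP => [_ /(_ erefl erefl)|]; rewrite ?addr0.
  + by case: eqP => [_ /(_ erefl erefl)|]; rewrite ?addr0.
- by apply: int_shift_add tv bM.2 (is_intN (is_int_nat _ 1)).
- have := in_basis_sat bM xy; have := in_basis_sat bN xy; rewrite !tab_addE.
  have := apart _ _ xy; have [->|_] := eqVneq x v; have [->|_] := eqVneq y v;
    rewrite ?(negbTE neuv) ?sym ?orbT ?orbF /= ?addr0 //.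
  + by case: eqP => [_ /(_ erefl erefl)|]; rewrite ?addr0.
  + by case: eqP => [_ /(_ erefl erefl)|]; rewrite ?addr0.
Qed.

End Basis.

(** * The Gelfand-Tsetlin coefficients as rational functions of the entries *)

Section Coefficients.
Variables (R : realType) (n : nat).
Implicit Types (M N : tableau R n) (u v w : vertex n).

Lemma eq_coef_den M N v :
  (forall w, vrow w = vrow v -> M w = N w) -> coef_den M v = coef_den N v.
Proof.
move=> eqMN; apply: eq_bigr => w /andP[/eqP wv _]; by rewrite (eqMN v) // eqMN.
Qed.

Lemma eq_coef_lower M N v :
  (forall w, vrow w = vrow v \/ (vrow w).+1 = vrow v :> nat -> M w = N w) ->
  coef_lower M v = coef_lower N v.
Proof.
move=> eqMN; congr (_ / _); last by apply: eq_coef_den => w wv; apply: eqMN; left.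
apply: eq_bigr => w /eqP wv; rewrite (eqMN v) ?(eqMN w) //; by [left|right].
Qed.

(** The cofactor of [M v - M w] in [coef_raise M v]. It is free of the entry at [w], which makes the
    coefficient affine in that entry. *)
Definition coef_raise_but M v w : R[i] :=
  (\prod_(x | (vrow x == (vrow v).+1 :> nat) && (x != w)) (M v - M x)) / coef_den M v.

Lemma coef_raiseE M v w : vrow w = (vrow v).+1 :> nat ->
  coef_raise M v = (M v - M w) * coef_raise_but M v w.
Proof.
by move=> wv; rewrite /coef_raise (bigD1 w) /= ?wv // mulrA.
Qed.

Lemma coef_raise_but_add M v w e : vrow w = (vrow v).+1 :> nat ->
  coef_raise_but (tab_add M w e) v w = coef_raise_but M v w.
Proof.
move=> wv; have nwv x : vrow x = vrow v -> (x == w) = false.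
  by move=> xv; apply: contra_eqF wv => /eqP <-; rewrite xv ltn_eqF.
congr (_ / _).
  by apply: eq_bigr => x /andP[_ /negbTE xw]; rewrite !tab_addE xw nwv // !addr0.
by apply: eq_coef_den => x /nwv xw; rewrite tab_addE xw addr0.
Qed.

Lemma coef_lower_add M v w e : vrow w = (vrow v).+1 :> nat ->
  coef_lower (tab_add M w e) v = coef_lower M v.
Proof.
move=> wv; apply: eq_coef_lower => x xv; rewrite tab_addE.
case: eqP => [xw|_]; last by rewrite addr0.
case: xv; rewrite xw => h; move: wv; [rewrite h|rewrite -h] => /eqP.
  by rewrite ltn_eqF.
by rewrite ltn_eqF // ltnS leqnSn.
Qed.

Lemma coef_den_add M u v e : vrow u = vrow v -> u != v ->
  coef_den (tab_add M v e) u = (M u - M v - e) *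
    \prod_(w | [&& vrow w == vrow u, w != u & w != v]) (M u - M w).
Proof.
move=> uv /negbTE neuv; rewrite /coef_den (bigD1 v) /=; last first.
  by rewrite uv eqxx; apply: contraFN neuv => /eqP ->.
rewrite !tab_addE eqxx neuv addr0 opprD addrA; congr (_ * _).
apply: eq_big => [w|w /andP[_ /negbTE wv]]; first by rewrite andbA.
by rewrite tab_addE wv addr0.
Qed.

(** The numerators involve only the neighbouring rows and the moved entry itself, so only the
    denominator factors joining [u] and [v] matter. With [x = M u - M v] both sides have the factor
    [- x * (x + 1)] there. *)
Lemma coef_exchange M u v : vrow u = vrow v -> u != v ->
  coef_lower M v * coef_raise (tab_add M v (-1)) u =
  coef_raise M u * coef_lower (tab_add M u 1) v.
Proof.
move=> uv neuv; have nevu : v != u by rewrite eq_sym.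
have row_neq x : vrow x != vrow u -> (x == u) = false /\ (x == v) = false.
  by move=> xu; split; apply: contraNF xu => /eqP ->; rewrite ?uv.
have tab_add0 N x : tab_add N x 0 = N.
  by apply/ffunP => y; rewrite tab_addE; case: eqP; rewrite addr0.
have nums : \prod_(w | vrow w == (vrow u).+1 :> nat)
      (tab_add M v (-1) u - tab_add M v (-1) w)
    = \prod_(w | vrow w == (vrow u).+1 :> nat) (M u - M w).
  apply: eq_bigr => w /eqP wu; have [_ wv] : (w == u) = false /\ (w == v) = false.
    by apply: row_neq; rewrite -val_eqE /= wu gtn_eqF.
  by rewrite !tab_addE wv (negbTE neuv) !addr0.
have numd : \prod_(w | (vrow w).+1 == vrow v :> nat) (tab_add M u 1 v - tab_add M u 1 w)
    = \prod_(w | (vrow w).+1 == vrow v :> nat) (M v - M w).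
  apply: eq_bigr => w /eqP wv; have [wu _] : (w == u) = false /\ (w == v) = false.
    by apply: row_neq; rewrite -val_eqE /= uv -wv ltn_eqF.
  by rewrite !tab_addE wu (negbTE nevu) !addr0.
have den0 x y : vrow x = vrow y -> x != y -> coef_den M x = (M x - M y) *
    \prod_(w | [&& vrow w == vrow x, w != x & w != y]) (M x - M w).
  by move=> xy nexy; rewrite -[in LHS](tab_add0 M y) coef_den_add // subr0.
rewrite /coef_lower /coef_raise nums numd !coef_den_add //.
rewrite (den0 u v) // (den0 v u) //.
rewrite !invfM; set p := \prod_(_ | _) _; set d := \prod_(_ | _) _.
set q := \prod_(_ | _) _; set d' := \prod_(_ | _) _.
have e : (M v - M u)^-1 * (M u - M v - -1)^-1 =
         (M u - M v)^-1 * (M v - M u - 1)^-1.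
  by rewrite -!invfM; congr _^-1; ring.
transitivity (p * q * d^-1 * d'^-1 * ((M v - M u)^-1 * (M u - M v - -1)^-1)).
  by ring.
by rewrite e; ring.
Qed.

End Coefficients.

(** * Where the coefficients vanish on basis tableaux *)

Section BasisCoefficients.
Variables (R : realType) (n : nat) (T : tableau R n).
Local Notation G := (tableau_graph T).
Hypothesis (wfG : wf_graph G) (ncG : noncritical G) (realT : realization G T).
Implicit Types (M N : tableau R n) (u v w : vertex n).

Lemma coef_den_neq0 M v : in_basis T M -> ~~ is_top v -> coef_den M v != 0.
Proof.
move=> bM tv; apply/prodf_neq0 => w /andP[/eqP wv nwv].
by apply: (in_basis_row_neq wfG ncG bM); rewrite 1?eq_sym.
Qed.

Lemma coef_raise_neq0 M v : in_basis T M -> in_basis T (tab_add M v 1) ->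
  coef_raise M v != 0.
Proof.
move=> bM bN; have tv : ~~ is_top v.
  by apply: in_basis_shift_nontop bM bN _; apply/eqP/oner_neq0.
rewrite mulf_neq0 ?invr_neq0 ?coef_den_neq0 //.
apply/prodf_neq0 => w /eqP wv; exact: (in_basis_adjacent_upper wfG bM bN).
Qed.

Lemma coef_lower_neq0 M v : in_basis T M -> in_basis T (tab_add M v (-1)) ->
  coef_lower M v != 0.
Proof.
move=> bM bN; have tv : ~~ is_top v.
  by apply: in_basis_shift_nontop bM bN _; apply/eqP; rewrite oppr_eq0 oner_neq0.
rewrite mulf_neq0 ?invr_neq0 ?coef_den_neq0 //.
apply/prodf_neq0 => w /eqP wv.
(* [M] is viewed as the raise of the lowered tableau, which brings the statement about raising to
   bear. *)
have bM' : in_basis T (tab_add (tab_add M v (-1)) v 1) by rewrite tab_addNK.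
have := in_basis_adjacent_lower wfG bN bM' wv; rewrite !tab_addE eqxx addrNK.
by case: (w =P v) wv => [->/eqP|_ _]; rewrite ?gtn_eqF ?addr0.
Qed.

Lemma coef_raise_eq0 M v w : vrow w = (vrow v).+1 :> nat -> M v - M w = 0 ->
  coef_raise M v = 0.
Proof. by move=> wv h; rewrite (coef_raiseE _ wv) h mul0r. Qed.

Lemma coef_lower_eq0 M v w : (vrow w).+1 = vrow v :> nat -> M v - M w = 0 ->
  coef_lower M v = 0.
Proof. by move=> wv h; rewrite /coef_lower (bigD1 w) ?wv //= h !mul0r. Qed.

(* Diagonal coefficients of [F_k E_k] and [E_k F_k] at the vertex [v], up to sign. *)
Definition raise_lower M v := coef_raise M v * coef_lower (tab_add M v 1) v.
Definition lower_raise M v := coef_lower M v * coef_raise (tab_add M v (-1)) v.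

Lemma raise_lower_eq0 M v : in_basis T M -> ~~ is_top v ->
  ~ in_basis T (tab_add M v 1) -> raise_lower M v = 0.
Proof.
move=> bM tv /(raise_blocked wfG realT bM tv)[[w [_ wv h]]|[w [_ wv h]]].
  by rewrite /raise_lower (coef_raise_eq0 wv h) mul0r.
rewrite /raise_lower (coef_lower_eq0 wv) ?mulr0 // !tab_addE eqxx.
by case: (w =P v) wv => [->/eqP|_ _]; rewrite ?gtn_eqF ?addr0.
Qed.

Lemma lower_raise_eq0 M v : in_basis T M -> ~~ is_top v ->
  ~ in_basis T (tab_add M v (-1)) -> lower_raise M v = 0.
Proof.
move=> bM tv /(lower_blocked wfG realT bM tv)[[w [_ wv h]]|[w [_ wv h]]].
  rewrite /lower_raise (coef_raise_eq0 wv) ?mulr0 // !tab_addE eqxx.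
  by case: (w =P v) wv => [->/eqP|_ _]; rewrite ?ltn_eqF ?addr0.
by rewrite /lower_raise (coef_lower_eq0 wv h) mul0r.
Qed.

End BasisCoefficients.

(** * Coordinates with respect to the basis tableaux *)

Lemma mkmalgU_scale (A : nzRingType) (K : choiceType) (k : K) (a : A) :
  mkmalgU k a = a *: mkmalgU k 1 :> {malg A[K]}.
Proof. by apply/malgP => c; rewrite mcoeffZ !mcoeffU mulr_natr. Qed.

Section TabVec.
Variables (R : realType) (n : nat) (T : tableau R n).
Local Notation G := (tableau_graph T).
Local Notation V := (VG G T).
Local Notation t := (tabvec G T).
Implicit Types (M N : tableau R n) (u v w : vertex n).

Lemma tabvec_basis (b : basis G T) : t (val b) = mkmalgU b 1.
Proof. by rewrite /tabvec valK. Qed.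

Lemma in_basis_ex M : in_basis T M -> exists b : basis G T, val b = M.
Proof. by move=> /asboolP h; exists (Sub M h); rewrite SubK. Qed.

Lemma tabvec_notin M : ~ in_basis T M -> t M = 0.
Proof. by move=> h; rewrite /tabvec insubN //; apply/asboolPn. Qed.

Lemma mcoeff_tabvec (b c : basis G T) :
  mcoeff b (t (val c) : {malg R[i][basis G T]}) = (c == b)%:R.
Proof. by rewrite tabvec_basis mcoeffU. Qed.

Lemma tabvec_neq0 M : in_basis T M -> t M != 0.
Proof.
move=> /in_basis_ex[b <-]; apply/eqP => /(congr1 (mcoeff b)).
by rewrite mcoeff_tabvec eqxx mcoeff0 => /eqP; rewrite oner_eq0.
Qed.

Lemma tabvec_span (x : V) :
  x = \sum_(b <- msupp (x : {malg R[i][basis G T]}))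
        mcoeff b (x : {malg R[i][basis G T]}) *: t (val b).
Proof.
rewrite {1}(monalgE (x : {malg R[i][basis G T]})); apply: eq_bigr => b _.
by rewrite tabvec_basis; apply: mkmalgU_scale.
Qed.

End TabVec.

(** * Submodules and the operators preserving them *)

Section Submodules.
Variables (R : realType) (n : nat) (V : lmodType R[i]).
Variable rho : 'M[R[i]]_n -> V -> V.
Implicit Types (W : V -> Prop) (X Y : {linear V -> V}).

Lemma submoduleZ W a x : submodule rho W -> W x -> W (a *: x).
Proof. by move=> [W0 WD _] Wx; rewrite -[_ *: _]addr0; apply: WD. Qed.

Lemma submoduleD W x y : submodule rho W -> W x -> W y -> W (x + y).
Proof. by move=> [_ WD _] Wx Wy; rewrite -[x]scale1r; apply: WD. Qed.

Lemma submoduleB W x y : submodule rho W -> W x -> W y -> W (x - y).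
Proof.
by move=> sW Wx Wy; apply: submoduleD => //; rewrite -scaleN1r; apply: submoduleZ.
Qed.

Lemma submodule_sum W (I : Type) (r : seq I) (P : pred I) (F : I -> V) :
  submodule rho W -> (forall i, P i -> W (F i)) -> W (\sum_(i <- r | P i) F i).
Proof.
move=> sW WF; apply: (big_ind W) => //; first by case: sW.
by move=> x y; apply: submoduleD.
Qed.

(** Plays the role of acting by an element of the enveloping algebra. *)
Definition preserving (X : V -> V) : Prop :=
  forall W, submodule rho W -> forall x, W x -> W (X x).

Lemma preserving_rho A : preserving (rho A).
Proof. by move=> W [_ _ h] x; apply: h. Qed.

Lemma preserving_comp X Y : preserving X -> preserving Y -> preserving (X \o Y).
Proof. by move=> hX hY W sW x Wx; apply: hX (hY _ sW _ Wx). Qed.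

Lemma preserving_sub X Y : preserving X -> preserving Y -> preserving (X \- Y).
Proof.
by move=> hX hY W sW x Wx /=; apply: submoduleB => //; [apply: hX|apply: hY].
Qed.

(* Eigenvectors of a submodule-preserving operator for distinct eigenvalues can
   be extracted from their sum by applying [X - eta u] and induction. *)
Lemma eigen_split W X (I : eqType) (r : seq I) (x : I -> V) (eta : I -> R[i]) :
  submodule rho W -> preserving X -> uniq r ->
  {in r &, forall u v, eta u = eta v -> u = v} ->
  {in r, forall u, X (x u) = eta u *: x u} ->
  W (\sum_(u <- r) x u) -> {in r, forall u, W (x u)}.
Proof.
move=> sW hX; elim: r x => [|a r IH] x //= /andP[ar ur] inj eig.
rewrite big_cons => Wsum.
have Wr : {in r, forall u, W (x u)}.
  have Wr' : {in r, forall u, W ((eta u - eta a) *: x u)}.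
    apply: IH => //.
    - by move=> u v ur' vr; apply: inj; rewrite inE ?ur' ?vr orbT.
    - by move=> u ur'; rewrite linearZ /= eig ?inE ?ur' ?orbT // !scalerA mulrC.
    have -> : \sum_(u <- r) (eta u - eta a) *: x u =
        X (x a + \sum_(u <- r) x u) - eta a *: (x a + \sum_(u <- r) x u).
      rewrite linearD linear_sum /= eig ?mem_head // scalerDr opprD addrACA subrr.
      rewrite add0r scaler_sumr -sumrB big_seq [RHS]big_seq.
      apply: eq_bigr => u ur'.
      by rewrite scalerBl eig // inE ur' orbT.
    by apply: submoduleB => //; [apply: hX|apply: submoduleZ].
  move=> u ur'; have nz : eta u - eta a != 0.
    rewrite subr_eq0; apply: contra ar => /eqP/inj <- //; rewrite inE ?eqxx //.
    by rewrite ur' orbT.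
  by rewrite -[x u]scale1r -(mulVf nz) -scalerA; apply: submoduleZ => //; apply: Wr'.
move=> u; rewrite inE => /predU1P[->|]; last exact: Wr.
rewrite -[x a](addrK (\sum_(u <- r) x u)); apply: submoduleB => //.
by rewrite big_seq; apply: submodule_sum.
Qed.

End Submodules.

(** * Separation of summands and generation by [T] *)

Section Module.
Variables (R : realType) (n : nat) (T : tableau R n).
Local Notation G := (tableau_graph T).
Hypothesis (wfG : wf_graph G) (ncG : noncritical G) (realT : realization G T).
Variables (V : lmodType R[i]) (t : tableau R n -> V).
Hypothesis tabvec_notin : forall M, ~ in_basis T M -> t M = 0.
Hypothesis tabvec_neq0 : forall M, in_basis T M -> t M != 0.
Variable rho : 'M[R[i]]_n -> V -> V.
Hypothesis glrho : gl_module rho.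
Hypothesis rho_raise : forall M (k k' : 'I_n), in_basis T M -> k' = k.+1 :> nat ->
  rho (delta_mx k k') (t M) =
  - \sum_(v | vrow v == k) coef_raise M v *: t (tab_add M v 1).
Hypothesis rho_lower : forall M (k k' : 'I_n), in_basis T M -> k' = k.+1 :> nat ->
  rho (delta_mx k' k) (t M) =
  \sum_(v | vrow v == k) coef_lower M v *: t (tab_add M v (-1)).
Hypothesis rho_weight : forall M (k : 'I_n), in_basis T M ->
  rho (delta_mx k k) (t M) = GT_weight M k *: t M.
Implicit Types (M N : tableau R n) (u v w : vertex n) (X : {linear V -> V}).

Lemma rho_linear A : linear (rho A).
Proof. by case: glrho. Qed.

Definition rhoL A : {linear V -> V} :=
  HB.pack (rho A) (GRing.isLinear.Build _ _ _ _ (rho A) (rho_linear A)).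

Lemma rho0 A : rho A 0 = 0. Proof. exact: (linear0 (rhoL A)). Qed.

Lemma rhoN A : {morph rho A : x / - x}. Proof. exact: (linearN (rhoL A)). Qed.

Lemma rhoZ A a : {morph rho A : x / a *: x}. Proof. exact: (linearZ_LR (rhoL A)). Qed.

Lemma rho_sum A (I : Type) (r : seq I) (Q : pred I) (F : I -> V) :
  rho A (\sum_(i <- r | Q i) F i) = \sum_(i <- r | Q i) rho A (F i).
Proof. exact: (linear_sum (rhoL A)). Qed.

Lemma rhoB A B x : rho (A - B) x = rho A x - rho B x.
Proof.
case: glrho => [_ h _].
by have := h x (-1) B A; rewrite /= !scaleN1r [- B + A]addrC [- _ + rho A x]addrC.
Qed.

Lemma rho0l x : rho 0 x = 0.
Proof. by have := rhoB 0 0 x; rewrite subr0 subrr. Qed.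

Lemma rho_bracket A B x :
  rho (A *m B - B *m A) x = rho A (rho B x) - rho B (rho A x).
Proof. by case: glrho. Qed.

Lemma tabvec_scale_inj M (a b : R[i]) : in_basis T M ->
  a *: t M = b *: t M -> a = b.
Proof.
move=> /tabvec_neq0 h /eqP; rewrite -subr_eq0 -scalerBl scaler_eq0 (negbTE h).
by rewrite orbF subr_eq0 => /eqP.
Qed.

Lemma row_nontop (k k' : 'I_n) v : k' = k.+1 :> nat -> vrow v = k -> ~~ is_top v.
Proof. by move=> kk vk; rewrite /is_top vk -kk ltn_eqF. Qed.

(* Off the diagonal the two products cancel (coef_exchange), and the summands
   dropped because a tableau is not a realization have coefficient 0. *)
Lemma raise_lower_bracket X (phi : R[i] -> R[i]) (k k' : 'I_n) M :
  k' = k.+1 :> nat ->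
  (forall N, in_basis T N -> X (t N) =
     - \sum_(u | vrow u == k) (phi (N u) * coef_raise N u) *: t (tab_add N u 1)) ->
  in_basis T M ->
  X (rho (delta_mx k' k) (t M)) - rho (delta_mx k' k) (X (t M)) =
  (\sum_(u | vrow u == k)
     (phi (M u) * raise_lower M u - phi (M u - 1) * lower_raise M u)) *: t M.
Proof.
move=> kk hX bM; rewrite (rho_lower bM kk) (hX _ bM).
have XF v : vrow v == k -> X (coef_lower M v *: t (tab_add M v (-1))) =
    - \sum_(u | vrow u == k) (phi (tab_add M v (-1) u) *
        (coef_lower M v * coef_raise (tab_add M v (-1)) u)) *:
        t (tab_add (tab_add M v (-1)) u 1).
  move=> /eqP vk; rewrite linearZ /=.
  case: (pselect (in_basis T (tab_add M v (-1)))) => [bN|nb].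
    rewrite hX // scalerN scaler_sumr; congr (- _); apply: eq_bigr => u _.
    by rewrite scalerA; congr (_ *: _); rewrite mulrCA.
  rewrite tabvec_notin // linear0 scaler0 big1 ?oppr0 // => u /eqP uk.
  have tv := row_nontop kk vk; have tu := row_nontop kk uk.
  have [uv|neuv] := eqVneq u v.
    by rewrite uv -/(lower_raise M v) (lower_raise_eq0 wfG realT bM tv nb) mulr0 scale0r.
  (* If the tableau after both moves were in the basis, so would be the one after the single move,
     by [in_basis_exchange]. *)
  rewrite (tabvec_notin (M := tab_add _ _ _)) ?scaler0 // tab_addC => b.
  by case: nb; case: (in_basis_exchange wfG realT bM _ neuv tu b); rewrite ?uk.
have FX u : vrow u == k ->
    rho (delta_mx k' k) ((phi (M u) * coef_raise M u) *: t (tab_add M u 1)) =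
    \sum_(v | vrow v == k) (phi (M u) *
        (coef_raise M u * coef_lower (tab_add M u 1) v)) *:
        t (tab_add (tab_add M u 1) v (-1)).
  move=> /eqP uk; rewrite rhoZ.
  case: (pselect (in_basis T (tab_add M u 1))) => [bN|nb].
    rewrite (rho_lower bN kk) scaler_sumr; apply: eq_bigr => v _.
    by rewrite scalerA mulrA.
  rewrite tabvec_notin // rho0 scaler0 big1 // => v /eqP vk.
  have tu := row_nontop kk uk.
  have [uv|neuv] := eqVneq u v.
    by rewrite -uv -/(raise_lower M u) (raise_lower_eq0 wfG realT bM tu nb) mulr0 scale0r.
  rewrite (tabvec_notin (M := tab_add _ _ _)) ?scaler0 // => b.
  by case: nb; case: (in_basis_exchange wfG realT bM _ neuv tu b); rewrite ?uk.
rewrite linear_sum /= (eq_bigr _ XF) rhoN rho_sum.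
rewrite (eq_bigr _ FX) sumrN opprK addrC exchange_big -sumrB.
rewrite scaler_suml; apply: eq_bigr => u uk; rewrite -sumrB (bigD1 u) //=.
(* On the diagonal, [phi] is evaluated at [M u] when [X] acts first and at [M u - 1] when lowering
   comes first. *)
rewrite tab_addK tab_addNK tab_addE eqxx -/(raise_lower M u) -/(lower_raise M u).
rewrite -scalerBl big1 ?addr0 // => v /andP[vk nevu].
rewrite tab_addE (negbTE nevu) addr0 coef_exchange //; last first.
  by rewrite (eqP uk) (eqP vk).
by rewrite [tab_add (tab_add M u _) _ _]tab_addC subrr.
Qed.

(** The bracket formula with [phi = 1], compared with [[E_{k,k+1}, E_{k+1,k}] = E_{kk} -
    E_{k+1,k+1}]. *)
Lemma sum_raise_lower M (k k' : 'I_n) : k' = k.+1 :> nat -> in_basis T M ->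
  \sum_(u | vrow u == k) (raise_lower M u - lower_raise M u) =
  GT_weight M k - GT_weight M k'.
Proof.
move=> kk bM; apply: (tabvec_scale_inj bM).
have h N : in_basis T N -> rhoL (delta_mx k k') (t N) =
    - \sum_(u | vrow u == k) (1 * coef_raise N u) *: t (tab_add N u 1).
  move=> bN; rewrite /= (rho_raise bN kk); congr (- _).
  by apply: eq_bigr => u _; rewrite mul1r.
have := raise_lower_bracket (phi := fun=> 1) kk h bM => /=.
rewrite -rho_bracket !mul_delta_mx rhoB !rho_weight // -scalerBl => ->.
by congr (_ *: _); apply: eq_bigr => u _; rewrite !mul1r.
Qed.

Lemma GT_weight_add M v e : GT_weight (tab_add M v e) (vrow v) = GT_weight M (vrow v) + e.
Proof.
rewrite /GT_weight (bigD1 v) //= [in RHS](bigD1 v) //= tab_addE eqxx.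
rewrite (eq_bigr M) => [|w /andP[_ /negbTE wv]]; last by rewrite tab_addE wv addr0.
rewrite [X in _ - X](eq_bigr M) => [|w /eqP wv]; first by ring.
by rewrite tab_addE (_ : (w == v) = false) ?addr0 //; apply: contra_eqF wv => /eqP ->;
   rewrite gtn_eqF.
Qed.

Lemma GT_weight_add_above M v e (k : 'I_n) : (k < vrow v)%N ->
  GT_weight (tab_add M v e) k = GT_weight M k.
Proof.
move=> kv; have h w : (vrow w <= k)%N -> tab_add M v e w = M w.
  move=> wk; rewrite tab_addE; case: eqP => [wv|]; last by rewrite addr0.
  by move: kv; rewrite -wv ltnNge wk.
rewrite /GT_weight; congr (_ + _ - _); apply: eq_bigr => w /eqP wk; apply: h.
  by rewrite wk.
by rewrite -wk.
Qed.

Definition second_moment M (k : 'I_n) : R[i] :=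
  \sum_(u | vrow u == k) (M u * raise_lower M u - (M u - 1) * lower_raise M u).

(* [raise_lower] and [lower_raise] are affine in the entry at [w], so the first
   moment at the two tableaux determines the increment of the second one. *)
Lemma second_moment_add M (k k' : 'I_n) w : k' = k.+1 :> nat -> vrow w = k' ->
  in_basis T M -> in_basis T (tab_add M w 1) ->
  second_moment (tab_add M w 1) k - second_moment M k =
  GT_weight M k' - GT_weight M k - M w.
Proof.
move=> kk wk bM bN.
pose B u := coef_raise_but M u w * coef_lower (tab_add M u 1) u.
pose A u := coef_lower M u * coef_raise_but (tab_add M u (-1)) u w.
have wu u : vrow u == k -> vrow w = (vrow u).+1 :> nat by move=> /eqP ->; rewrite wk.
have uw u : vrow u == k -> (u == w) = false /\ (w == u) = false.
  by move=> /wu h; split; apply: contra_eqF h => /eqP ->; rewrite ltn_eqF.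
have hB u : vrow u == k -> raise_lower M u = (M u - M w) * B u.
  by move=> uk; rewrite /raise_lower (coef_raiseE _ (wu u uk)) -mulrA.
have hB' u : vrow u == k -> raise_lower (tab_add M w 1) u = (M u - M w - 1) * B u.
  move=> uk; rewrite /raise_lower (coef_raiseE _ (wu u uk)).
  rewrite (coef_raise_but_add _ _ (wu u uk)).
  rewrite tab_addC (coef_lower_add _ _ (wu u uk)) !tab_addE eqxx (uw u uk).1 /B; ring.
have hA u : vrow u == k -> lower_raise M u = (M u - 1 - M w) * A u.
  move=> uk; rewrite /lower_raise (coef_raiseE _ (wu u uk)) !tab_addE eqxx.
  by rewrite (uw u uk).2 /A; ring.
have hA' u : vrow u == k -> lower_raise (tab_add M w 1) u = (M u - 1 - M w - 1) * A u.
  move=> uk; rewrite /lower_raise (coef_lower_add _ _ (wu u uk)) tab_addC.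
  rewrite (coef_raiseE _ (wu u uk)) (coef_raise_but_add _ _ (wu u uk)) !tab_addE !eqxx.
  by rewrite (uw u uk).1 (uw u uk).2 /A; ring.
have m1 : \sum_(u | vrow u == k) ((M u - M w) * B u - (M u - 1 - M w) * A u) =
    GT_weight M k - GT_weight M k'.
  by rewrite -sum_raise_lower //; apply: eq_bigr => u uk; rewrite hB ?hA.
have m2 : \sum_(u | vrow u == k) ((M u - M w - 1) * B u - (M u - 1 - M w - 1) * A u) =
    GT_weight M k - GT_weight M k' - 1.
  rewrite -addrA -opprD -{1}wk -GT_weight_add wk.
  rewrite -(GT_weight_add_above M 1 (k := k) (v := w)) ?wk ?kk //.
  by rewrite -sum_raise_lower //; apply: eq_bigr => u uk; rewrite hB' ?hA'.
(* The second moment changes by minus the sum of [M u * B u - (M u - 1) * A u]. That sum is [m1]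
   plus [M w] times the sum of [B u - A u], and the latter is [m1] minus [m2]. *)
have -> : GT_weight M k' - GT_weight M k - M w =
  - (GT_weight M k - GT_weight M k') - M w *
  ((GT_weight M k - GT_weight M k') - (GT_weight M k - GT_weight M k' - 1)) by ring.
rewrite -m2 -m1 -!sumrB mulr_sumr -sumrN -sumrB.
apply: eq_bigr => u uk; rewrite hB // hB' // hA // hA' // tab_addE (uw u uk).1; ring.
Qed.

Lemma rho_weight_root M (k a b : 'I_n) : in_basis T M ->
  rho (delta_mx k k) (rho (delta_mx a b) (t M)) =
  (GT_weight M k + ((k == a)%:Z - (k == b)%:Z)%:~R) *: rho (delta_mx a b) (t M).
Proof.
move=> bM; have := rho_bracket (delta_mx k k) (delta_mx a b) (t M).
rewrite rho_weight // rhoZ rhoB !mul_delta_mx_cond => /esym/eqP.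
rewrite subr_eq => /eqP ->; rewrite [in RHS]scalerDl [RHS]addrC; congr (_ + _).
rewrite intrB scalerBl [b == k]eq_sym; congr (_ - _).
  by case: eqP => [->|_]; rewrite ?scale1r ?scale0r ?mulr0n ?rho0l.
by case: eqP => [->|_]; rewrite ?scale1r ?scale0r ?mulr0n ?rho0l.
Qed.

(** For fixed [M] the eigenvalues of [X] on the raised tableaux differ only through [- M u], and the
    [M u] are distinct. [Y] makes the common term [c M] available as an operator, to be cancelled
    when passing to the next row. *)
Definition row_separating (k : 'I_n) X (Y : {linear V -> V})
    (h c : tableau R n -> R[i]) : Prop :=
  [/\ preserving rho X, preserving rho Y,
      forall M, in_basis T M -> X (t M) = h M *: t M,
      forall M, in_basis T M -> Y (t M) = c M *: t M
    & forall M u, vrow u = k -> in_basis T M -> in_basis T (tab_add M u 1) ->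
        h (tab_add M u 1) = h M + c M - M u /\ c (tab_add M u 1) = c M + 1].

Lemma GT_weight_row0 M u (k : 'I_n) : k = 0 :> nat -> vrow u = k -> GT_weight M k = M u.
Proof.
move=> k0 uk; rewrite /GT_weight (bigD1 u) /= ?uk // k0.
rewrite !big1 ?addr0 ?subr0 ?add0r // => v /andP[/eqP vk /eqP nvu].
case: nvu; apply: vertex_inj; first by rewrite uk vk.
have := valP v; have := valP u; rewrite -/(vrow u) -/(vrow v) uk vk k0 !leqn0.
by move=> /eqP uc /eqP vc; rewrite /vcol uc vc.
Qed.

(** The lowest row has one entry, equal to its weight, so nothing has to be separated: [c M - M u]
    is 0. *)
Lemma row_separating0 (k : 'I_n) : k = 0 :> nat ->
  row_separating k \0 (rhoL (delta_mx k k)) (fun=> 0) (fun M => GT_weight M k).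
Proof.
move=> k0; split.
- by move=> W [].
- exact: preserving_rho.
- by move=> M _; rewrite scale0r.
- by move=> M bM; apply: rho_weight.
- move=> M u uk _ _; rewrite -uk GT_weight_add uk (GT_weight_row0 _ k0 uk).
  by rewrite add0r subrr.
Qed.

(* [E' := E Y - [X, E]] acts as [E = E_{k,k+1}] with the summand moving the entry
   [M u] multiplied by [M u]; its bracket with [F = E_{k+1,k}] separates row [k + 1]. *)
Lemma row_separatingS (k k' : 'I_n) X Y h c : k' = k.+1 :> nat ->
  row_separating k X Y h c ->
  exists X' Y' h' c', row_separating k' X' Y' h' c'.
Proof.
move=> kk [pX pY hX hY hc].
pose E := rhoL (delta_mx k k'); pose F := rhoL (delta_mx k' k).
have pE : preserving rho E by apply: preserving_rho.
have pF : preserving rho F by apply: preserving_rho.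
pose E' : {linear V -> V} := (E \o Y) \- ((X \o E) \- (E \o X)).
have pE' : preserving rho E'.
  by do !apply: preserving_sub; apply: preserving_comp.
have hE' N : in_basis T N -> E' (t N) =
    - \sum_(u | vrow u == k) (N u * coef_raise N u) *: t (tab_add N u 1).
  move=> bN; rewrite /E' /= hX // hY // !rhoZ (rho_raise bN kk).
  rewrite !scalerN (linearN X) (linear_sum X) /=.
  have opp3 (a b x : V) : - a - (- x - - b) = - (a + b - x).
    by rewrite !opprD !opprK addrA addrAC.
  rewrite opp3 -scalerDl; congr (- _).
  rewrite scaler_sumr -sumrB; apply: eq_bigr => u /eqP uk.
  rewrite (linearZ_LR X) /=; case: (pselect (in_basis T (tab_add N u 1))) => [bN'|nb].
    rewrite hX // !scalerA -scalerBl; congr (_ *: _).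
    by have [-> _] := hc _ _ uk bN bN'; ring.
  by rewrite tabvec_notin // (linear0 X) !scaler0 subr0.
(* [Y'] is chosen to have as eigenvalue the term [c] found in [second_moment_add]. *)
exists ((E' \o F) \- (F \o E')), (rhoL (delta_mx k' k') \- rhoL (delta_mx k k)).
exists (second_moment^~ k), (fun M => GT_weight M k' - GT_weight M k).
split.
- by apply: preserving_sub; apply: preserving_comp.
- by apply: preserving_sub; apply: preserving_rho.
- by move=> M bM; apply: (raise_lower_bracket (phi := id) kk hE' bM).
- by move=> M bM /=; rewrite !rho_weight // -scalerBl.
- move=> M w wk bM bN; split.
    rewrite -[LHS](subrK (second_moment M k)) (second_moment_add kk wk bM bN).
    by rewrite addrC addrA.
  have kw : (k < vrow w)%N by rewrite wk kk.
  by rewrite (GT_weight_add_above _ _ kw) -wk GT_weight_add; ring.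
Qed.

Lemma row_separating_ex (k : 'I_n) : exists X Y h c, row_separating k X Y h c.
Proof.
case: k => m; elim: m => [|m IH] hm.
  exists \0, (rhoL (delta_mx (Ordinal hm) (Ordinal hm))).
  by exists (fun=> 0), (fun M => GT_weight M (Ordinal hm)); apply: row_separating0.
by have [X [Y [h [c /row_separatingS]]]] := IH (ltnW hm); apply.
Qed.

Lemma in_basis_nontop M v e : in_basis T M -> in_basis T (tab_add M v e) -> e != 0 ->
  exists k' : 'I_n, k' = (vrow v).+1 :> nat.
Proof.
move=> bM bN e0; have tv : ~~ is_top v.
  by apply: in_basis_shift_nontop bM bN _; apply/eqP.
have hv : ((vrow v).+1 < n)%N by rewrite ltn_neqAle tv ltn_ord.
by exists (Ordinal hv).
Qed.

Lemma submodule_raise (W : V -> Prop) M v : submodule rho W -> in_basis T M ->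
  in_basis T (tab_add M v 1) -> W (t M) -> W (t (tab_add M v 1)).
Proof.
move=> sW bM bN WM; have [k' kk] := in_basis_nontop bM bN (oner_neq0 _).
have [X [Y [h [c [pX _ hX _ hc]]]]] := row_separating_ex (vrow v).
have Wsum : W (\sum_(u <- enum [pred u | vrow u == vrow v])
    coef_raise M u *: t (tab_add M u 1)).
  rewrite big_enum /=.
  have := preserving_rho (delta_mx (vrow v) k') sW WM; rewrite (rho_raise bM kk).
  by move=> /(submoduleZ (-1) sW); rewrite scaleN1r opprK.
have := eigen_split (eta := fun u => h M + c M - M u) sW pX (enum_uniq _) _ _ Wsum.
move=> /(_ _ _ v) Wv; have : W (coef_raise M v *: t (tab_add M v 1)).
  apply: Wv => [u1 u2|u|]; rewrite ?mem_enum ?inE //.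
    move=> /eqP u1v /eqP u2v /addrI/oppr_inj h12; apply/eqP/negPn/negP => ne.
    have := in_basis_row_neq wfG ncG bM (etrans u1v (esym u2v)) (row_nontop kk u1v) ne.
    by rewrite h12 subrr eqxx.
  move=> /eqP uv; rewrite (linearZ_LR X) /= scalerA.
  (* Outside the basis the summand is 0, hence an eigenvector for whatever value [eta] assigns. *)
  case: (pselect (in_basis T (tab_add M u 1))) => [bN'|nb].
    by rewrite hX // scalerA mulrC; have [-> _] := hc _ _ uv bM bN'.
  by rewrite tabvec_notin // (linear0 X) !scaler0.
move=> /(submoduleZ (coef_raise M v)^-1 sW); rewrite scalerA mulVf ?scale1r //.
exact: (coef_raise_neq0 wfG ncG bM bN).
Qed.

Lemma submodule_lower (W : V -> Prop) M v : submodule rho W -> in_basis T M ->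
  in_basis T (tab_add M v (-1)) -> W (t M) -> W (t (tab_add M v (-1))).
Proof.
move=> sW bM bN WM.
have N10 : -1 != 0 :> R[i] by rewrite oppr_eq0 oner_neq0.
have [k' kk] := in_basis_nontop bM bN N10.
have [X [Y [h [c [pX _ hX _ hc]]]]] := row_separating_ex (vrow v).
have Wsum : W (\sum_(u <- enum [pred u | vrow u == vrow v])
    coef_lower M u *: t (tab_add M u (-1))).
  by rewrite big_enum /= -(rho_lower bM kk); apply: (preserving_rho _ sW).
have := eigen_split (eta := fun u => h M - c M + M u) sW pX (enum_uniq _) _ _ Wsum.
move=> /(_ _ _ v) Wv; have : W (coef_lower M v *: t (tab_add M v (-1))).
  apply: Wv => [u1 u2|u|]; rewrite ?mem_enum ?inE //.
    move=> /eqP u1v /eqP u2v /addrI h12; apply/eqP/negPn/negP => ne.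
    have := in_basis_row_neq wfG ncG bM (etrans u1v (esym u2v)) (row_nontop kk u1v) ne.
    by rewrite h12 subrr eqxx.
  move=> /eqP uv; rewrite (linearZ_LR X) /= scalerA.
  case: (pselect (in_basis T (tab_add M u (-1)))) => [bN'|nb].
    rewrite hX // scalerA mulrC; congr (_ * _ *: _).
    (* [M] is the raise of [N = tab_add M u (-1)]; the increments of [c] and of the entry at [u]
       cancel, leaving [h N = h M - c M + M u]. *)
    have := hc _ _ uv bN'; rewrite tab_addNK => /(_ bM)[-> ->].
    by rewrite tab_addE eqxx; ring.
  by rewrite tabvec_notin // (linear0 X) !scaler0.
move=> /(submoduleZ (coef_lower M v)^-1 sW); rewrite scalerA mulVf ?scale1r //.
exact: (coef_lower_neq0 wfG ncG bM bN).
Qed.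

(** Reachability in [pregraph T] is antisymmetric, so these cardinals are strictly monotone along
    arrows and serve as ranks for choosing extremal vertices. *)
Lemma arrow_card_reach (u v : vertex n) : arrow (pregraph T) u v ->
  (#|reach (pregraph T) v| < #|reach (pregraph T) u|)%N /\
  (#|(reach (pregraph T))^~ u| < #|(reach (pregraph T))^~ v|)%N.
Proof.
move=> uv; have ruv : reach (pregraph T) u v by apply: connect1.
have nvu : ~~ reach (pregraph T) v u.
  apply/negP => vu; apply: (arrow_pregraph_neq uv).
  exact: pregraph_anti ruv vu.
split; apply: proper_card; apply/properP; split.
- by apply/subsetP => w; apply: connect_trans.
- by exists u; rewrite // /in_mem /= /reach connect0.
- by apply/subsetP => w /connect_trans; apply.
- by exists v; rewrite // /in_mem /= /reach connect0.
Qed.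

(** [e] is the least gap the relation allows. [T] exceeds it by some [m] and [M] by nothing, so
    [z v - z u = m]. *)
Lemma tight_shift_le M (z : vertex n -> int) (u v : vertex n) (e : nat) :
  (forall w, M w = T w + (z w)%:~R) ->
  is_nonneg_int (T u - T v - e%:R) -> M u - M v = e%:R -> (z u <= z v)%R.
Proof.
move=> hz [m hm]; rewrite !hz => h.
have : (z v - z u)%:~R = (m%:Z)%:~R :> R[i].
  by rewrite intrB -[RHS]hm -h; ring.
by move=> /intr_inj h'; rewrite -subr_ge0 h'.
Qed.

Lemma tight_arrow_le M (z : vertex n -> int) (u v : vertex n) :
  (forall w, M w = T w + (z w)%:~R) -> arrow (pregraph T) u v ->
  (vrow v = (vrow u).+1 :> nat /\ M u - M v = 1) \/
  (vrow u = (vrow v).+1 :> nat /\ M u - M v = 0) -> (z u <= z v)%R.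
Proof.
move=> hz /satisfies_pregraph + [[hr h]|[hr h]]; rewrite hr.
  rewrite leqnn => -[m hm]; apply: (tight_shift_le (e := 1)) hz _ h.
  by exists m; rewrite hm -natr1 addrK.
rewrite ltnNge leqnSn /= => hm; apply: (tight_shift_le (e := 0)) hz _ h.
by rewrite subr0.
Qed.

(** Take [v] of least rank among the entries to be raised (or lowered). A sharp arrow blocking the
    move would come from (or lead to) a [w] with a shift of the same sign, by [tight_arrow_le], and
    of smaller rank. *)
Lemma toward_T M (z : vertex n -> int) : in_basis T M ->
  (forall v, is_top v -> z v = 0) -> (forall v, M v = T v + (z v)%:~R) ->
  (exists v, z v != 0) ->
  exists v, (0 < z v)%R /\ in_basis T (tab_add M v (-1)) \/
            (z v < 0)%R /\ in_basis T (tab_add M v 1).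
Proof.
move=> bM z0 hz [v0 nz]; have [neg|pos|v00] := ltgtP (z v0) 0; last 1 first.
- by rewrite v00 in nz.
- pose v := [arg min_(v < v0 | (z v < 0)%R) #|(reach (pregraph T))^~ v|].
  have [vneg vmin] : (z v < 0)%R /\ forall w, (z w < 0)%R ->
      (#|(reach (pregraph T))^~ v| <= #|(reach (pregraph T))^~ w|)%N.
    by rewrite /v; case: arg_minnP.
  exists v; right; split=> //; apply: contrapT => nb.
  have tv : ~~ is_top v by apply/negP => /z0 h; rewrite h in vneg.
  have key w : arrow (pregraph T) w v -> (z w <= z v)%R -> False.
    move=> wv le; have := vmin w (le_lt_trans le vneg).
    by rewrite leqNgt (arrow_card_reach wv).2.
  have [[w [wv hr h]]|[w [wv hr h]]] := raise_blocked wfG realT bM tv nb.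
    apply: (key w wv); apply: tight_arrow_le hz wv _; right; split=> //.
    by rewrite -opprB h oppr0.
  apply: (key w wv); apply: tight_arrow_le hz wv _; left; split=> //.
  by rewrite -[RHS]subr0 -h; ring.
- pose v := [arg min_(v < v0 | (0 < z v)%R) #|reach (pregraph T) v|].
  have [vpos vmin] : (0 < z v)%R /\ forall w, (0 < z w)%R ->
      (#|reach (pregraph T) v| <= #|reach (pregraph T) w|)%N.
    by rewrite /v; case: arg_minnP.
  exists v; left; split=> //; apply: contrapT => nb.
  have tv : ~~ is_top v by apply/negP => /z0 h; rewrite h in vpos.
  have key w : arrow (pregraph T) v w -> (z v <= z w)%R -> False.
    move=> vw le; have := vmin w (lt_le_trans vpos le).
    by rewrite leqNgt (arrow_card_reach vw).1.
  have [[w [vw hr h]]|[w [vw hr h]]] := lower_blocked wfG realT bM tv nb.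
    apply: (key w vw); apply: tight_arrow_le hz vw _; left; split=> //.
    by rewrite -[RHS]add0r -h; ring.
  by apply: (key w vw); apply: tight_arrow_le hz vw _; right; split.
Qed.

Lemma submodule_full (W : V -> Prop) M : submodule rho W -> W (t T) ->
  in_basis T M -> W (t M).
Proof.
move=> sW WT bM; have [z [z0 hz]] := bM.2.
have [m] := ubnP (\sum_v `|z v|%N)%N.
elim: m M z bM z0 hz => // m IH M z bM z0 hz; rewrite ltnS => lem.
have [/existsP nz|/existsPn zz] := boolP [exists v, z v != 0]; last first.
  suff -> : M = T by [].
  by apply/ffunP => v; rewrite hz; have /negPn/eqP -> := zz v; rewrite addr0.
have step v (e : int) : in_basis T (tab_add M v e%:~R) ->
    (absz (z v + e)%R < absz (z v))%N ->
    e != 0 -> W (t (tab_add M v e%:~R)).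
  move=> bN lt e0; pose z' w := z w + if w == v then e else 0.
  have tv : ~~ is_top v.
    by apply: in_basis_shift_nontop bM bN _; apply/eqP; rewrite intr_eq0.
  apply: (IH _ z' bN).
  - by move=> w tw; rewrite /z' z0 //; case: eqP tw => [->|]; rewrite ?(negbTE tv).
  - by move=> w; rewrite tab_addE hz /z' intrD addrA; case: eqP.
  - apply: leq_trans lem; rewrite (bigD1 v) //= [X in (_ < X)%N](bigD1 v) //=.
    rewrite /z' eqxx (eq_bigr (fun w => `|z w|%N)).
      by rewrite ltn_add2r.
    by move=> w /negbTE ->; rewrite addr0.
(* The neighbour closer to [T] is reached by induction on the total shift, and the opposite unit
   move leads back to [M]. *)
have [v [[zv bN]|[zv bN]]] := toward_T bM z0 hz nz.
  have bN' : in_basis T (tab_add M v (-1)%:~R) by [].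
  rewrite -(tab_addNK M v 1); apply: submodule_raise => //; rewrite ?tab_addNK //.
  by apply: (step v (-1)) => //; lia.
rewrite -(tab_addK M v 1); apply: submodule_lower => //; rewrite ?tab_addK //.
by apply: (step v 1) => //; lia.
Qed.

End Module.

(** * Sums over vertices by rows and columns *)

Section RowSums.
Variables (n : nat) (A : nmodType).

Lemma vertex_ex (r c : 'I_n) : (c <= r)%N ->
  exists v : vertex n, vrow v = r /\ vcol v = c.
Proof. by move=> cr; exists (exist _ (r, c) cr). Qed.

Lemma sum_vertex (P : pred 'I_n) (f : 'I_n -> 'I_n -> A) :
  \sum_(v : vertex n | P (vrow v)) f (vrow v) (vcol v) =
  \sum_(r | P r) \sum_(c : 'I_n | (c <= r)%N) f r c.
Proof.
rewrite (partition_big (@vrow n) P) //=; apply: eq_bigr => r Pr.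
rewrite (partition_big (@vcol n) (fun c => (c <= r)%N)) /=; last first.
  by move=> v /andP[_ /eqP <-]; apply: (valP v).
apply: eq_bigr => c cr; have [v [vr vc]] := vertex_ex cr.
rewrite (big_pred1 v) ?vr ?vc // => w; rewrite /= -andbA; apply/idP/eqP => [|->].
  by move=> /and3P[_ /eqP wr /eqP wc]; apply: vertex_inj; rewrite ?vr ?vc ?wr ?wc.
by rewrite vr vc !eqxx Pr.
Qed.

Lemma sum_row (k : 'I_n) (f : 'I_n -> 'I_n -> A) :
  \sum_(v : vertex n | vrow v == k) f (vrow v) (vcol v) =
  \sum_(c : 'I_n | (c <= k)%N) f k c.
Proof. by rewrite (sum_vertex (pred1 k)) big_pred1_eq. Qed.

Lemma sum_row_pred (k : 'I_n) (f : nat -> 'I_n -> A) :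
  \sum_(v : vertex n | (vrow v).+1 == k) f (vrow v) (vcol v) =
  \sum_(c : 'I_n | (c < k)%N) f k.-1 c.
Proof.
rewrite (sum_vertex (fun r : 'I_n => r.+1 == k :> nat) (fun r => f r)).
(* For [k = 0] both sums are empty, so the truncated [k.-1] does no harm. *)
case: k => -[|k] hk /=; first by rewrite !big_pred0.
by rewrite (big_pred1 (Ordinal (ltnW hk))) //= => r; rewrite -val_eqE.
Qed.

End RowSums.

(** * The tableau [Tsigma s X]: entries and weight *)

Section Tsigma.
Variables (R : realType) (n : nat) (s : 'S_n) (X : 'rV[R[i]]_n).
Local Notation T := (Tsigma s X).
Local Notation si := (s^-1%g).

Lemma Tsigma_step (u v : vertex n) : vcol u = vcol v -> vrow u = (vrow v).+1 :> nat ->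
  T v = T u + (si (vrow u) < si (vcol u))%N%:R.
Proof.
move=> hc hr; have [down up] := Tsigma_rec s X hc hr.
have [hS hQ] := GsigmaP s.
have e1 := Sigma_arrow u v hS hQ; have e2 := Sigma_arrow v u hS hQ.
rewrite hc hr !eqxx /= [_ == _.+2]ltn_eqF ?orbF // in e1 e2; rewrite hc.
have [lt|le] := ltnP (si (vrow u)) (si (vcol v)); first by rewrite up // e2.
rewrite addr0 down // e1 ltn_neqAle le andbT; apply/negP => /eqP/ord_inj/perm_inj h.
by have := valP v; rewrite -/(vcol v) h hr ltnn.
Qed.

(** Accumulates [Tsigma_step] down the column from the top row. *)
Lemma TsigmaE (v : vertex n) : T v = X 0 (si (vcol v)) +
  (\sum_(r : 'I_n | (vrow v < r)%N) (si r < si (vcol v))%N)%:R.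
Proof.
have [m] := ubnP (n - vrow v); elim: m v => // m IH v lem.
have [tv|tv] := boolP (is_top v).
  rewrite Tsigma_top // big_pred0 ?addr0 // => r.
  by move: tv (ltn_ord r); rewrite /is_top => /eqP {2}<-; rewrite ltnS leqNgt => /negbTE.
have hv : ((vrow v).+1 < n)%N by rewrite ltn_neqAle tv ltn_ord.
have [u [ur uc]] : exists u : vertex n, vrow u = Ordinal hv /\ vcol u = vcol v.
  by apply: vertex_ex; apply: leqW (valP v).
rewrite (Tsigma_step uc) ?ur // IH ?ur ?uc //=; last by lia.
rewrite [in RHS](bigD1 (Ordinal hv)) //= natrD addrA addrAC; congr (_ + _%:R + _).
by apply: eq_bigl => r; rewrite -val_eqE /= (ltn_neqAle (vrow v).+1) eq_sym andbC.
Qed.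

Lemma Tsigma_realization : realization (tableau_graph T) T.
Proof.
apply: tableau_graph_realization => v tv.
have hv : ((vrow v).+1 < n)%N by rewrite ltn_neqAle tv ltn_ord.
have [u [ur uc]] : exists u : vertex n, vrow u = Ordinal hv /\ vcol u = vcol v.
  by apply: vertex_ex; apply: leqW (valP v).
exists u; first by rewrite ur.
rewrite (Tsigma_step uc) ?ur // opprD addrA subrr sub0r.
exact/is_intN/is_int_nat.
Qed.

Lemma sum_perm_lt (k : 'I_n) : (\sum_(c : 'I_n) (si c < si k))%N = si k.
Proof.
rewrite (reindex_inj (@perm_inj _ s)) /=.
under eq_bigr do rewrite permK.
have -> : (\sum_(c : 'I_n) (c < si k) = \sum_(c : 'I_n | (c < si k)%N) 1)%N.
  by rewrite [RHS]big_mkcond; apply: eq_bigr => c _; case: ifP.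
rewrite -(big_ord_widen n (fun=> 1%N)) ?sum1_card ?card_ord //.
exact: ltnW.
Qed.

(** Columns [c < k] cancel between the two rows except for the count [a], which turns the summand
    [k] into [b]. Column [k] contributes [X 0 (si k) + d], and [b + d] counts all indices whose
    image under [si] is below [si k]. *)
Lemma GT_weight_Tsigma (k : 'I_n) : GT_weight T k = X 0 (si k) + (si k)%:R.
Proof.
pose f r (c : 'I_n) : R[i] :=
  X 0 (si c) + (\sum_(q : 'I_n | (r < q)%N) (si q < si c)%N)%:R.
have Tf v : T v = f (vrow v) (vcol v) by rewrite TsigmaE.
rewrite /GT_weight !(eq_bigr _ (fun v _ => Tf v)).
rewrite (sum_row k (fun r => f r)) sum_row_pred (bigD1 k) //=.
have fk (c : 'I_n) : (c < k)%N -> f k.-1 c = f k c + (si k < si c)%N%:R.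
  move=> ck; rewrite /f (bigD1 k) /=; last by lia.
  rewrite natrD addrA addrAC; congr (_ + _%:R + _); apply: eq_bigl => q.
  by rewrite -val_eqE /=; lia.
rewrite [X in _ - X](eq_bigr _ fk) [X in _ - X]big_split /=.
rewrite [X in _ + (_ + X)](eq_bigl (fun c : 'I_n => (c < k)%N)); last first.
  by move=> c; rewrite -val_eqE /= ltn_neqAle andbC.
set F := \sum_(c < n | (c < k)%N) f k c; rewrite -natr_sum.
set a := (\sum_(c < n | (c < k)%N) (si k < si c))%N.
pose b := (\sum_(c < n | (c < k)%N) (si c < si k))%N.
have ab : (a + b = k)%N.
  rewrite -big_split /= -{2}[k : nat]card_ord -sum1_card.
  rewrite (big_ord_widen n (fun=> 1%N)) ?(ltnW (ltn_ord k)) //.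
  apply: eq_bigr => c ck; case: ltngtP => // /ord_inj/perm_inj kc.
  by rewrite kc ltnn in ck.
rewrite {1}/f; set d := (\sum_(q < n | (k < q)%N) (si q < si k))%N.
have bd : (b + d = si k)%N.
  rewrite -[RHS]sum_perm_lt (bigD1 k) //= ltnn add0n.
  rewrite (bigID (fun c : 'I_n => (c < k)%N)) /=; congr (_ + _)%N; apply: eq_bigl => c.
    by rewrite -val_eqE /=; lia.
  by rewrite -val_eqE /=; lia.
rewrite -bd natrD (_ : k%:R = a%:R + b%:R); last by rewrite -natrD ab.
by ring.
Qed.

End Tsigma.

(** By Abel summation the left side is the sum of the products assumed nonnegative; passing from [m]
    to [m.+1] adds exactly one of them. *)
Lemma abel_column_ge0 (y S : nat -> int) (c m : nat) : (c <= m)%N ->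
  (forall r, (c <= r < m)%N -> 0 <= (S r.+1 - S c) * (y r.+1 - y r)) ->
  0 <= \sum_(c <= r < m) y r * (S r - S r.+1) + y m * (S m - S c).
Proof.
elim: m => [|m IH]; first by rewrite leqn0 => /eqP -> _; rewrite big_nil subrr mulr0.
rewrite leq_eqVlt => /predU1P[-> _|]; first by rewrite big_geq // subrr mulr0.
rewrite ltnS => cm h; rewrite big_nat_recr //=.
have IHm : 0 <= \sum_(c <= r < m) y r * (S r - S r.+1) + y m * (S m - S c).
  by apply: IH => // r /andP[cr rm]; apply: h; rewrite cr ltnW.
have := h m; rewrite cm leqnn => /(_ erefl) hm.
by have := addr_ge0 IHm hm; congr (0 <= _); ring.
Qed.

(** * Weights of basis tableaux compared with the weight of [T] *)

Section Dominance.
Variables (R : realType) (n : nat) (s : 'S_n) (X : 'rV[R[i]]_n).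
Local Notation T := (Tsigma s X).
Local Notation si := (s^-1%g).
Hypothesis wfG : wf_graph (tableau_graph T).

(** In [T] the relation between [u] and [v] is sharp, pointing up or down according to the order of
    their images under [si]. Since [M] satisfies it too, the sign of [z u - z v] is forced. *)
Lemma Tsigma_column_ge0 M (z : vertex n -> int) (u v : vertex n) : in_basis T M ->
  (forall w, M w = T w + (z w)%:~R) ->
  vcol u = vcol v -> vrow u = (vrow v).+1 :> nat ->
  0 <= ((si (vrow u))%:Z - (si (vcol u))%:Z) * (z u - z v).
Proof.
move=> bM hz hc hr; have sat := in_basis_sat wfG bM.
have step := Tsigma_step s X hc hr.
case: ltnP step => [lt|le] /= step.
  have ar : arrow (pregraph T) v u.
    by apply: arrow_up_pregraph => //; exists 0%N; rewrite step addrAC subrr add0r.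
  have := sat _ _ ar; rewrite hr leqnn !hz step => -[m hm].
  have e : (z v - z u + 1)%:~R = (m.+1%:Z)%:~R :> R[i].
    by rewrite intrD intrB -[RHS]hm; ring.
  by move/intr_inj: e; nia.
have ar : arrow (pregraph T) u v.
  by apply: arrow_down_pregraph => //; exists 0%N; rewrite step addr0 subrr.
have := sat _ _ ar; rewrite hr ltnNge leqnSn /= !hz step => -[m hm].
have e : (z u - z v)%:~R = (m%:Z)%:~R :> R[i].
  by rewrite intrB -[RHS]hm; ring.
by move/intr_inj: e; nia.
Qed.

(* The weight of a basis tableau is that of [T] minus a nonnegative combination
   of the roots in [s (Delta^+)], tested here on the functional [e_k |-> s^-1 k]. *)
Lemma Tsigma_weight_le M (d : 'I_n -> int) : in_basis T M ->
  (forall k, GT_weight M k = GT_weight T k + (d k)%:~R) ->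
  0 <= \sum_k (si k)%:Z * d k.
Proof.
move=> bM hd; have [z [z0 hz]] := bM.2.
have dE k : d k = \sum_(v | vrow v == k) z v - \sum_(v | (vrow v).+1 == k :> nat) z v.
  apply: (@intr_inj R[i]); apply: (addrI (GT_weight T k)); rewrite -hd intrB !rmorph_sum.
  by rewrite /GT_weight !(eq_bigr _ (fun v _ => hz v)) !big_split /=; ring.
(* The default value occurs only at the index [n], where it is multiplied by a top-row shift, which
   is 0. *)
pose S m : int := Posz (if insub m is Some k then si (k : 'I_n) else 0%N).
have SE (k : 'I_n) : S k = si k by rewrite /S -[nat_of_ord k]/(val k) valK.
have -> : \sum_k (si k)%:Z * d k = \sum_v z v * (S (vrow v) - S (vrow v).+1).
  under eq_bigr do rewrite dE mulrBr -SE !mulr_sumr.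
  rewrite sumrB.
  under [RHS]eq_bigr do rewrite mulrBr.
  rewrite [RHS]sumrB; congr (_ - _).
    rewrite [RHS](partition_big (@vrow n) predT) //=; apply: eq_bigr => k _.
    by apply: eq_bigr => v /eqP ->; rewrite mulrC.
  rewrite (exchange_big_dep predT) //=; apply: eq_bigr => v _.
  have [/z0 ->|tv] := boolP (is_top v).
    by rewrite mul0r big1 // => k _; rewrite mulr0.
  have hv : ((vrow v).+1 < n)%N by rewrite ltn_neqAle tv ltn_ord.
  by rewrite mulrC (big_pred1 (Ordinal hv)) // => k; rewrite -val_eqE eq_sym.
(* [z] as a function of row number and column, 0 where there is no vertex; each column becomes a
   sequence to which Abel summation applies. *)
pose zz r (c : 'I_n) := \sum_(v | (vrow v == r :> nat) && (vcol v == c)) z v.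
have zzE v : zz (vrow v) (vcol v) = z v by rewrite /zz (big_pred1 v).
under eq_bigr do rewrite -zzE.
rewrite (sum_vertex predT (fun r c => zz r c * (S r - S r.+1))) /=.
rewrite (exchange_big_dep predT) //=; apply: sumr_ge0 => c _.
have nS : n = n.-1.+1 by rewrite (ltn_predK (ltn_ord c)).
have cn : (c <= n.-1)%N by rewrite -ltnS -nS.
(* The added boundary term is 0 because the top row does not move; it gives the shape required by
   [abel_column_ge0]. *)
have -> : \sum_(r < n | (c <= r)%N) zz r c * (S r - S r.+1) =
    \sum_(c <= r < n.-1) zz r c * (S r - S r.+1) + zz n.-1 c * (S n.-1 - S c).
  rewrite -(big_geq_mkord c n predT (fun r => zz r c * (S r - S r.+1))).
  have zz0 r : r = n.-1 -> zz r c = 0.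
    move=> rn; rewrite /zz big1 // => v /andP[/eqP vr _]; apply: z0.
    by rewrite /is_top vr rn -nS.
  rewrite (big_cat_nat cn (leq_pred n)) /= [zz n.-1 c]zz0 // mul0r; congr (_ + _).
  by rewrite big_nat big1 // => r hr; rewrite zz0 ?mul0r //; lia.
apply: (@abel_column_ge0 (zz^~ c) S c n.-1) => // r /andP[cr rn].
have hr : (r.+1 < n)%N by rewrite nS.
have [u [ur uc]] := @vertex_ex n (Ordinal hr) c (leqW cr).
have [v [vr vc]] := @vertex_ex n (Ordinal (ltnW hr)) c cr.
have := @Tsigma_column_ge0 M z u v bM hz (etrans uc (esym vc)); rewrite ur vr.
by move=> /(_ erefl); rewrite -!zzE ur uc vr vc -!SE.
Qed.

End Dominance.

(** * Weight vectors and the conclusion *)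

Lemma mcoeff_linear (A : nzRingType) (K : choiceType) (k : K) (a : A)
    (x y : {malg A[K]}) : mcoeff k (a *: x + y) = a * mcoeff k x + mcoeff k y.
Proof. by rewrite mcoeffD mcoeffZ. Qed.

Lemma diagonal_coord (A : fieldType) (V : lmodType A) (I : eqType) (t : I -> V)
    (f : V -> A) (D : V -> V) (w : I -> A) (i : I) (r : seq I) (a : I -> A) :
  (forall c x y, f (c *: x + y) = c * f x + f y) -> linear D ->
  (forall j, D (t j) = w j *: t j) -> (forall j, f (t j) = (j == i)%:R) ->
  f (D (\sum_(j <- r) a j *: t j)) = w i * f (\sum_(j <- r) a j *: t j).
Proof.
move=> fl Dl Dt ft.
have f0 : f 0 = 0 by have := fl (-1) 0 0; rewrite scaler0 addr0 mulN1r addNr.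
have D0 : D 0 = 0 by have := Dl (-1) 0 0; rewrite scaler0 addr0 scaleN1r addNr.
elim: r => [|j r IH]; first by rewrite !big_nil D0 f0 mulr0.
rewrite !big_cons Dl Dt !fl IH mulrDr; congr (_ + _).
have := fl (w j) (t j) 0; rewrite !addr0 f0 addr0 => ->.
by rewrite ft; case: eqP => [->|_]; rewrite ?mulr0 // !mulr1 mulrC.
Qed.

(** Diagonal operators act on each coordinate by a scalar, so any basis tableau with nonzero
    coordinate in [x] has the weight of [x]. *)
Lemma tabvec_weight (R : realType) (n : nat) (T : tableau R n)
    (rho : 'M[R[i]]_n -> VG (tableau_graph T) T -> VG (tableau_graph T) T)
    (x : VG (tableau_graph T) T) (mu : 'I_n -> R[i]) :
  (forall A, linear (rho A)) ->
  (forall M k, in_basis T M -> rho (delta_mx k k) (tabvec (tableau_graph T) T M) =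
                GT_weight M k *: tabvec (tableau_graph T) T M) ->
  (forall k, rho (delta_mx k k) x = mu k *: x) -> x != 0 ->
  exists2 M, in_basis T M & forall k, GT_weight M k = mu k.
Proof.
move=> lin weight xmu /eqP nz.
pose coord b (y : VG (tableau_graph T) T) :=
  mcoeff b (y : {malg R[i][basis (tableau_graph T) T]}).
have coordP b c y z : coord b (c *: y + z) = c * coord b y + coord b z.
  exact: mcoeff_linear.
have [b xb] : exists b, coord b x != 0.
  apply: contrapT => h; apply: nz; rewrite (tabvec_span x) big1 // => b _.
  rewrite (_ : mcoeff b _ = 0) ?scale0r //.
  by apply/eqP/negPn/negP => xb; apply: h; exists b.
have bM : in_basis T (val b) by have /asboolP := valP b.
exists (val b) => // k; apply: (mulIf xb).
have e : coord b (mu k *: x) = mu k * coord b x.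
  have e0 : coord b 0 = 0 := mcoeff0 b.
  by rewrite -[in LHS](addr0 (mu k *: x)) coordP e0 addr0.
rewrite -e -xmu.
have Dt (c : basis (tableau_graph T) T) :
    rho (delta_mx k k) (tabvec _ T (val c)) = GT_weight (val c) k *: tabvec _ T (val c).
  by apply: weight; have /asboolP := valP c.
have ft (c : basis (tableau_graph T) T) : coord b (tabvec _ T (val c)) = (c == b)%:R.
  exact: mcoeff_tabvec.
have := diagonal_coord (msupp (x : {malg R[i][basis (tableau_graph T) T]}))
  (fun c => coord c x) (coordP b) (lin (delta_mx k k)) Dt ft.
by rewrite -(tabvec_span x).
Qed.

Lemma Tsigma_highest_weight_vector (R : realType) (n : nat) (lam : 'rV[R[i]]_n)
    (s : 'S_n) (T := Tsigma s (lambda_bar lam)) (V : lmodType R[i])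
    (t : tableau R n -> V) (rho : 'M[R[i]]_n -> V -> V) :
  wf_graph (tableau_graph T) -> t T != 0 -> gl_module rho ->
  (forall M k, in_basis T M -> rho (delta_mx k k) (t M) = GT_weight M k *: t M) ->
  (forall x mu, (forall k, rho (delta_mx k k) x = mu k *: x) -> x != 0 ->
     exists2 M, in_basis T M & forall k, GT_weight M k = mu k) ->
  highest_weight_vector rho s lam (t T).
Proof.
move=> wfG nz glrho weight weights.
have bT : in_basis T T := in_basis_T (Tsigma_realization s (lambda_bar lam)).
split; first exact/eqP.
  (* The shift by [- i] in [lambda_bar] cancels the summand [si (s i) = i] of the weight. *)
  by move=> i; rewrite weight // GT_weight_Tsigma permK mxE subrK.
move=> i j ij; apply/eqP/negPn/negP.
move=> /(weights _ _ (fun k => rho_weight_root glrho weight k (s i) (s j) bT))[M bM wM].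
have := Tsigma_weight_le wfG bM wM.
under eq_bigr do rewrite mulrBr; rewrite sumrB.
rewrite (bigD1 (s i)) //= big1 => [|k /negbTE ->]; last by rewrite mulr0.
rewrite [X in _ - X](bigD1 (s j)) //= big1 => [|k /negbTE ->]; last by rewrite mulr0.
by rewrite !eqxx !permK !mulr1 !addr0; lia.
Qed.

(** The realization property makes [tabvec G T T] a genuine basis vector instead of 0, and the
    existence of [rho] keeps the last claim from being vacuous. *)
Theorem theorem4p14 (R : realType) (n : nat) (hn : (2 <= n)%N)
    (lam : 'rV[R[i]]_n) (s : 'S_n) :
  let T := Tsigma s (lambda_bar lam) in
  let G := tableau_graph T in
  relation_graph R G ->
  [/\ realization G T,
      exists rho : 'M[R[i]]_n -> VG G T -> VG G T, GT_module rho
    & forall rho : 'M[R[i]]_n -> VG G T -> VG G T, GT_module rho ->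
        highest_weight_vector rho s lam (tabvec G T T)
        /\ highest_weight_module rho s lam].
Proof.
move=> T G [wfG ncG exrho].
have realT : realization G T := Tsigma_realization s (lambda_bar lam).
split=> //; first exact: exrho.
move=> rho [glrho GTrho].
have bT : in_basis T T := in_basis_T realT.
have raise M (k k' : 'I_n) : in_basis T M -> k' = k.+1 :> nat ->
    rho (delta_mx k k') (tabvec G T M) =
    - \sum_(v | vrow v == k) coef_raise M v *: tabvec G T (tab_add M v 1).
  by move=> /in_basis_ex[b <-] kk; case: (GTrho b) => h _ _; apply: h.
have lower M (k k' : 'I_n) : in_basis T M -> k' = k.+1 :> nat ->
    rho (delta_mx k' k) (tabvec G T M) =
    \sum_(v | vrow v == k) coef_lower M v *: tabvec G T (tab_add M v (-1)).
  by move=> /in_basis_ex[b <-] kk; case: (GTrho b) => _ h _; apply: h.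
have weight M (k : 'I_n) : in_basis T M ->
    rho (delta_mx k k) (tabvec G T M) = GT_weight M k *: tabvec G T M.
  by move=> /in_basis_ex[b <-]; case: (GTrho b) => _ _ h; apply: h.
have neq0 M : in_basis T M -> tabvec G T M != 0 by apply: tabvec_neq0.
have notin M : ~ in_basis T M -> tabvec G T M = 0 by apply: tabvec_notin.
have lin A : linear (rho A) by case: glrho.
have hwv : highest_weight_vector rho s lam (tabvec G T T).
  apply: (Tsigma_highest_weight_vector wfG (neq0 _ bT) glrho weight) => x mu.
  exact: (tabvec_weight lin weight).
split=> //; exists (tabvec G T T); split=> // W sW WT x.
rewrite (tabvec_span x); apply: (submodule_sum _ sW) => b _.
apply: (submoduleZ _ sW).
have bM : in_basis T (val b) by have /asboolP := valP b.
exact: (submodule_full wfG ncG realT notin neq0 glrho raise lower weight sW WT bM).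
Qed.
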